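(* For every integer $k\ge2$ there exists $C>0$ such that for every sequence of integers $f:\mathbb N\to\mathbb N$ satisfying $f(l)\ge C\,l\,(2k-1)^{l/3}$ for all sufficiently large $l$, asymptotically almost surely (as $l\to\infty$) a random $k$-generated group in the Gromov model $\mathcal G(k,l,f)$ has Kazhdan's property (T). In particular, for every $k\geq 2$ and every density $d\in(\frac13,1)$, asymptotically almost surely a random group in the Gromov density model $\mathcal D(k,l,d)$ has Kazhdan's property (T).
   Context: Gromov model $\mathcal G(k,l,f)$: fix an integer $k\ge2$, a set of generators $\mathcal A$ with $|\mathcal A|=k$ and $f:\mathbb N\to\mathbb N$. A random group is $\Gamma=\langle\mathcal A\mid R\rangle$, where $R$ is a collection of cyclically reduced words of length $l$ in $\mathcal A\cup\mathcal A^{-1}$, of cardinality $f(l)$, chosen uniformly at random (so $f(l)$ is understood not to exceed the number of such words). When $f(l)$ is the integral part of $(2k-1)^{dl}$ with $d\in(0,1)$ constant, the model is the Gromov density model $\mathcal D(k,l,d)$. A property holds asymptotically almost surely if its probability tends to $1$ as $l\to\infty$. *)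

(* Defs.v *)
From HB Require Import structures.
From mathcomp Require Import all_boot all_order all_algebra.
From mathcomp Require Import all_classical all_reals all_analysis.
From mathcomp Require Import complex sesquilinear.

Set Implicit Arguments.
Unset Strict Implicit.
Unset Printing Implicit Defensive.

Import Order.TTheory GRing.Theory Num.Theory.
Import numFieldNormedType.Exports.

Local Open Scope classical_set_scope.
Local Open Scope ring_scope.
Local Open Scope quotient_scope.

(* (a, false) stands for the generator a, and (a, true) for its inverse. *)
Definition letter (A : Type) : Type := (A * bool)%type.
HB.instance Definition _ (A : choiceType) := Choice.on (letter A).
HB.instance Definition _ (A : finType) := Finite.on (letter A).

Definition inv_letter A (x : letter A) : letter A := (x.1, ~~ x.2).

Definition word (A : Type) : Type := seq (letter A).
HB.instance Definition _ (A : choiceType) := Choice.on (word A).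

Definition inv_word A (u : word A) : word A := rev (map (@inv_letter A) u).

(* [cycle e] also compares the last letter with the first one; a word of
   length at most 1 is cyclically reduced. *)
Definition cyclically_reduced (A : eqType) (w : word A) : bool :=
  cycle (fun x y : A * bool => y != inv_letter x) w.

Section Presentation.
Context (A : choiceType) (rels : set (word A)).

Inductive pres_eq : word A -> word A -> Prop :=
| pres_eq_refl u : pres_eq u u
| pres_eq_sym u v : pres_eq u v -> pres_eq v u
| pres_eq_trans v u w : pres_eq u v -> pres_eq v w -> pres_eq u w
| pres_eq_cancel u x v : pres_eq (u ++ [:: x; inv_letter x] ++ v) (u ++ v)
| pres_eq_rel u r v : rels r -> pres_eq (u ++ r ++ v) (u ++ v).

Definition pres_eqb (u v : word A) : bool := `[< pres_eq u v >].

Lemma pres_eqb_refl : reflexive pres_eqb.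
Proof. by move=> u; apply/asboolP; exact: pres_eq_refl. Qed.

Lemma pres_eqb_sym : symmetric pres_eqb.
Proof. by move=> u v; apply/asboolP/asboolP; exact: pres_eq_sym. Qed.

Lemma pres_eqb_trans : transitive pres_eqb.
Proof.
move=> v u w /asboolP uv /asboolP vw; apply/asboolP; exact: pres_eq_trans uv vw.
Qed.

Canonical pres_equiv : equiv_rel (word A) :=
  EquivRel pres_eqb pres_eqb_refl pres_eqb_sym pres_eqb_trans.

(* The group < A | rels >. *)
Definition presented : Type := {eq_quot pres_equiv}.
HB.instance Definition _ := Choice.on presented.
HB.instance Definition _ := EqQuotient.on presented.

Lemma pres_eq_ctx p q u v : pres_eq u v -> pres_eq (p ++ u ++ q) (p ++ v ++ q).
Proof.
elim=> {u v} [u|u v _ IH|v u w _ IH1 _ IH2|u x v|u r v r_rel].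
- exact: pres_eq_refl.
- exact: pres_eq_sym.
- exact: pres_eq_trans IH1 IH2.
- by have := pres_eq_cancel (p ++ u) x (v ++ q); rewrite -!catA.
- by have := pres_eq_rel (p ++ u) (v ++ q) r_rel; rewrite -!catA.
Qed.

Lemma pres_eq_cat u u' v v' :
  pres_eq u u' -> pres_eq v v' -> pres_eq (u ++ v) (u' ++ v').
Proof.
move=> /(pres_eq_ctx [::] v) uu' /(pres_eq_ctx u' [::]); rewrite !cats0.
exact: pres_eq_trans uu'.
Qed.

Lemma inv_letterK : involutive (@inv_letter A).
Proof. by case=> a b; rewrite /inv_letter negbK. Qed.

Lemma inv_wordK : involutive (@inv_word A).
Proof.
by move=> u; rewrite /inv_word map_rev revK -map_comp (eq_map inv_letterK) map_id.
Qed.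

Lemma pres_eq_mulV u : pres_eq (u ++ inv_word u) [::].
Proof.
elim: u => [|x u IH]; first exact: pres_eq_refl.
have -> : (x :: u) ++ inv_word (x :: u) =
          [:: x] ++ (u ++ inv_word u) ++ [:: inv_letter x].
  by rewrite /inv_word /= rev_cons -cats1 !catA.
apply: pres_eq_trans (pres_eq_ctx [:: x] [:: inv_letter x] IH) _.
exact: (pres_eq_cancel [::] x [::]).
Qed.

Lemma pres_eq_Vmul u : pres_eq (inv_word u ++ u) [::].
Proof. by have := pres_eq_mulV (inv_word u); rewrite inv_wordK. Qed.

Lemma pres_eq_inv u v : pres_eq u v -> pres_eq (inv_word u) (inv_word v).
Proof.
move=> uv; have := pres_eq_ctx (inv_word u) (inv_word v) uv.
rewrite (catA _ u) => h.
have e1 := pres_eq_ctx [::] (inv_word v) (pres_eq_Vmul u).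
have e2 := pres_eq_ctx (inv_word u) [::] (pres_eq_mulV v).
rewrite !cats0 in e2; rewrite /= in e1.
apply: pres_eq_trans (pres_eq_sym e2) _.
exact: pres_eq_trans (pres_eq_sym h) e1.
Qed.

Lemma pres_piP u v : reflect (pres_eq u v) (\pi_presented u == \pi_presented v).
Proof. by rewrite eqmodE; exact: asboolP. Qed.

Lemma pres_repr u : pres_eq (repr (\pi_presented u)) u.
Proof. by apply/pres_piP; rewrite reprK. Qed.

Definition pres_one : presented := \pi_presented [::].
Definition pres_inv (g : presented) : presented :=
  \pi_presented (inv_word (repr g)).
Definition pres_mul (g h : presented) : presented :=
  \pi_presented (repr g ++ repr h).

Lemma pres_mul_pi u v :
  pres_mul (\pi_presented u) (\pi_presented v) = \pi_presented (u ++ v).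
Proof. by apply/eqP/pres_piP/pres_eq_cat; exact: pres_repr. Qed.

Lemma pres_inv_pi u : pres_inv (\pi_presented u) = \pi_presented (inv_word u).
Proof. by apply/eqP/pres_piP/pres_eq_inv; exact: pres_repr. Qed.

Lemma pres_ind (P : presented -> Prop) :
  (forall u, P (\pi_presented u)) -> forall g, P g.
Proof. by move=> Ppi g; rewrite -[g]reprK. Qed.

Lemma pres_mulA : associative pres_mul.
Proof. by do 3![elim/pres_ind => ?]; rewrite !pres_mul_pi catA. Qed.

Lemma pres_mul1g : left_id pres_one pres_mul.
Proof. by elim/pres_ind => u; rewrite pres_mul_pi. Qed.

Lemma pres_mulg1 : right_id pres_one pres_mul.
Proof. by elim/pres_ind => u; rewrite pres_mul_pi cats0. Qed.

Lemma pres_mulVg : left_inverse pres_one pres_inv pres_mul.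
Proof.
elim/pres_ind => u; rewrite pres_inv_pi pres_mul_pi.
by apply/eqP/pres_piP; exact: pres_eq_Vmul.
Qed.

Lemma pres_mulgV : right_inverse pres_one pres_inv pres_mul.
Proof.
elim/pres_ind => u; rewrite pres_inv_pi pres_mul_pi.
by apply/eqP/pres_piP; exact: pres_eq_mulV.
Qed.

HB.instance Definition _ := isGroup.Build presented
  pres_mulA pres_mul1g pres_mulg1 pres_mulVg pres_mulgV.

End Presentation.

(* A complex Hilbert space is a complete normed space [H] over R[i] with an
   inner product [dot] (linear in the first variable) inducing its norm. *)
Definition hilbert (R : realType) (H : completeNormedModType R[i])
    (dot : {dot H for Num.conj}) : Prop :=
  forall v : H, dot v v = `|v| ^+ 2.

(* Invertibility of the operators [rho g] follows from the first two clauses. *)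
Definition unitary_rep (R : realType) (H : completeNormedModType R[i])
    (dot : {dot H for Num.conj}) (G : groupType) (rho : G -> {linear H -> H}) :
    Prop :=
  [/\ forall v, rho 1%g v = v,
      forall g h v, rho (g * h)%g v = rho g (rho h v)
    & forall g v w, dot (rho g v) (rho g w) = dot v w].

(* Property (T) of a discrete group: there is a Kazhdan pair (Q, eps), with Q
   finite. *)
Definition property_T (R : realType) (G : groupType) : Prop :=
  exists (Q : seq G) (eps : R), 0 < eps /\
    forall (H : completeNormedModType R[i]) (dot : {dot H for Num.conj})
           (rho : G -> {linear H -> H}),
      hilbert dot -> unitary_rep dot rho ->
      (exists2 v : H, v != 0 &
         forall g, g \in Q -> `|rho g v - v| < eps%:C%C * `|v|) ->
      exists2 v : H, v != 0 & forall g, rho g v = v.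

Definition cyc_words (k l : nat) : {set l.-tuple (letter 'I_k)} :=
  [set w : l.-tuple (letter 'I_k) | cyclically_reduced w]%SET.

Definition relator_sets (k l m : nat) : {set {set l.-tuple (letter 'I_k)}} :=
  [set S : {set l.-tuple (letter 'I_k)} | (S \subset cyc_words k l) && (#|S| == m)]%SET.

Definition gromov_group (k l : nat) (S : {set l.-tuple (letter 'I_k)}) : groupType :=
  presented ((fun w : l.-tuple (letter 'I_k) => w : word 'I_k) @` [set` S]).

(* The probability that <A | S> satisfies P, for S uniform in the (finite) set
   [relator_sets k l m]. *)
Definition gromov_prob (R : realType) (k l m : nat) (P : groupType -> Prop) : R :=
  #|[set S in relator_sets k l m | `[< P (gromov_group S) >]]%SET|%:R
  / #|relator_sets k l m|%:R.

(* "Asymptotically almost surely P" in the Gromov model G(k, l, f). *)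
Definition gromov_aas (R : realType) (k : nat) (f : nat -> nat)
    (P : groupType -> Prop) : Prop :=
  gromov_prob R k l (f l) P @[l --> \oo] --> (1 : R).

Definition density_count (R : realType) (k : nat) (d : R) (l : nat) : nat :=
  Num.truncn ((2 * k%:R - 1) `^ (d * l%:R)).

(* Main.v *)
Require Import Defs.
From HB Require Import structures.
From mathcomp Require Import all_boot all_order all_fingroup all_algebra.
From mathcomp Require Import all_classical all_reals all_analysis.
From mathcomp Require Import complex sesquilinear lra ring zify.

Set Implicit Arguments.
Unset Strict Implicit.
Unset Printing Implicit Defensive.

Import Order.TTheory GRing.Theory Num.Theory.
Import numFieldNormedType.Exports.

Local Open Scope classical_set_scope.
Local Open Scope ring_scope.
Local Open Scope quotient_scope.

(** The proof bounds the probability of failure by O((2k-1)^-l), through a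
    variant of Zuk's spectral criterion.

    Relators.  Put K = 2k - 1, let x and y be two of the generators, and write
    l = 3m + 2j + 4 with j <= 2.  A loop is a reduced word of length m which
    begins with y and ends with y^-1.  For loops u0, u1, u2 the word
    (y^j u0 y^-j) (x u1 x^-1) (x^-1 u2 x) is cyclically reduced of length l.
    Words of this form make up a fraction of all relators that is bounded below
    in terms of k only, and in such a random relator the three loops are
    independent.  Each of the three families of sides is stable under inversion,
    so joining each side to the inverse of the preceding one gives a graph on
    the sides, the link, which is tripartite and whose mean is a multiple of the
    complete tripartite graph, for every residue of l modulo 3.

    The criterion.  Let v be a vector of a unitary representation and
    f(g) = g v - v.  If w0 w1 w2 = 1 then
    |f(w_i) - f(w_{i-1}^-1)| = |f(w_{i+1})|; summing over the relators, twice
    <f, A f> is the sum of |f|^2 weighted by degrees, where A is the adjacency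
    matrix of the link.  When A is near its mean and the degrees are not too
    small, this gives the spectral gap <Lv, v> <= 8 |Lv|^2 for the operator L
    which averages 1 - g over the sides g (good_gap).  Iterating v - Lv/2 then
    converges to a vector fixed by all sides and close to v
    (spectral_gap_fixed), and a vector fixed by those sides yields one fixed by
    the whole group (sum_fixed).  Hence property (T)
    (property_T_of_good_relators).

    Concentration.  To compare A with its mean, subtract an independent copy of
    the sample and put random signs on the differences.  The trace of a power
    of the signed sum is then a sum over closed walks using each relator an even
    number of times (signed_trace_le); with moments of order comparable to l,
    and moments of the degrees bounded by exponential moments, A is near its
    mean except with probability O(K^-l), once the mean degree is at least a
    large multiple of l (bad_sample_prob).  This is where the condition on f
    comes from: the mean degree is of order f(l) K^(-l/3).  The inequality
    psd_trace_moment passes from traces of powers to Hilbert space valued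
    functions, whose Gram matrices are positive semidefinite.

    The model.  The estimates above are for independent relators.  Relators can
    only be added without harm to the criterion, and a uniform subset of f(l)
    relators contains, up to a uniform permutation of all relators, any f(l)
    prescribed ones; so its probability of failure is at most that of an
    independent sample of size f(l) (random_subset_le_sample).

    The statement about the density model follows, since K^(dl) outgrows
    l K^(l/3) when d > 1/3, and is at most the number of cyclically reduced
    words when d < 1. *)


(** * Positive semidefinite matrices and traces of powers *)

Section PsdTrace.
Variables (R : realFieldType) (n : nat).
Implicit Types (C D G Y : 'M[R]_n) (c : 'rV[R]_n).

Lemma discriminant_le (a b c : R) :
  (forall t, 0 <= a + 2 * t * b + t ^+ 2 * c) -> b ^+ 2 <= a * c.
Proof.
move=> h; have a0 : 0 <= a by have := h 0; rewrite mulr0 mul0r expr0n /= mul0r !addr0.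
have [c0|c0|c0] := ltrgt0P c.
- have := h (- b / c).
  have -> : a + 2 * (- b / c) * b + (- b / c) ^+ 2 * c = (a * c - b ^+ 2) / c.
    by field; rewrite gt_eqF.
  by rewrite pmulr_lge0 ?invr_gt0// subr_ge0.
- have := h ((a + 1) / - c + 1); have := h (- ((a + 1) / - c + 1)).
  set t := (a + 1) / - c + 1 => h1 h2; exfalso.
  have t1 : 1 <= t by rewrite lerDr divr_ge0 ?addr_ge0// oppr_ge0 ltW.
  have tc : t * - c = a + 1 - c.
    by rewrite /t; field; rewrite lt_eqF.
  have : 0 <= (a + t ^+ 2 * c) *+ 2 by lra.
  rewrite pmulrn_lge0//.
  have -> : a + t ^+ 2 * c = a - t * (t * - c) by ring.
  rewrite tc; nra.
- subst c; rewrite mulr0.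
  have [-> |b0] := eqVneq b 0; first by rewrite expr0n.
  have := h (- (a + 1) / (2 * b)).
  have -> : a + 2 * (- (a + 1) / (2 * b)) * b + (- (a + 1) / (2 * b)) ^+ 2 * 0 = -1.
    by field; rewrite b0.
  by rewrite oppr_ge0 ler10.
Qed.

Definition psd G := forall c, 0 <= (c *m G *m c^T) 0 0.

Lemma psd_trace_ge0 G C : psd G -> 0 <= \tr (C *m G *m C^T).
Proof.
move=> Gpsd; apply: sumr_ge0 => i _; have := Gpsd (row i C).
rewrite -row_mul !mxE => h; apply: le_trans h _.
by rewrite le_eqVlt; apply/orP; left; apply/eqP/eq_bigr => j _; rewrite !mxE.
Qed.

(** The form (C, D) |-> tr (C G D^T) is symmetric and nonnegative on the
    diagonal, so it satisfies the Cauchy-Schwarz inequality. *)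
Lemma psd_trace_CS G C D : G^T = G -> psd G ->
  \tr (C *m G *m D^T) ^+ 2 <= \tr (C *m G *m C^T) * \tr (D *m G *m D^T).
Proof.
move=> Gs Gpsd; apply: discriminant_le => t.
have := psd_trace_ge0 (C + t *: D) Gpsd.
have e : \tr (D *m G *m C^T) = \tr (C *m G *m D^T).
  by rewrite -mxtrace_tr !trmx_mul trmxK Gs mulmxA.
rewrite linearD linearZ /= !(mulmxDl, mulmxDr) -!(scalemxAl, scalemxAr).
rewrite !(linearD, linearZ) /= e => h; apply: le_trans h _.
by rewrite le_eqVlt; apply/orP; left; apply/eqP; ring.
Qed.

Lemma trmx_exp Y r : Y^T = Y -> (Y ^+ r)^T = Y ^+ r.
Proof.
move=> Ys; elim: r => [|r IHr]; first by rewrite expr0 trmx1.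
by rewrite [in LHS]exprS trmx_mul IHr Ys -[_ *m _]/(_ * _) -exprSr.
Qed.

Lemma psd_trace_sq Y G : Y^T = Y -> G^T = G -> psd G ->
  \tr (Y *m G) ^+ 2 <= \tr (Y ^+ 2 *m G) * \tr G.
Proof.
move=> Ys Gs Gpsd; have := psd_trace_CS Y 1%:M Gs Gpsd.
by rewrite mul1mx trmx1 !mulmx1 Ys [\tr (Y *m G *m Y)]mxtrace_mulC mulmxA -[Y *m Y]/(Y * Y) -expr2.
Qed.

(** Repeated squaring: each step is the Cauchy-Schwarz inequality for a power of
    Y and the identity.  Only exponents that are powers of two are reached, which
    avoids diagonalizing Y. *)
Lemma psd_trace_pow Y G q : Y^T = Y -> G^T = G -> psd G ->
  \tr (Y *m G) ^+ (2 ^ q.+1) <= \tr (Y ^+ (2 ^ q.+1) *m G) * \tr G ^+ (2 ^ q.+1).-1.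
Proof.
move=> Ys Gs Gpsd; elim: q => [|q IH].
  by rewrite expn1 expr1; exact: psd_trace_sq.
have p0 : (0 < 2 ^ q.+1)%N by rewrite expn_gt0.
have h0 : 0 <= \tr (Y *m G) ^+ (2 ^ q.+1) by rewrite expnSr exprM sqr_ge0.
rewrite [(2 ^ q.+2)%N]expnSr !exprM.
apply: (@le_trans _ _ ((\tr (Y ^+ (2 ^ q.+1) *m G) * \tr G ^+ (2 ^ q.+1).-1) ^+ 2)).
  by rewrite lerXn2r ?nnegrE// (le_trans h0).
have h := psd_trace_sq (trmx_exp (2 ^ q.+1) Ys) Gs Gpsd.
rewrite exprMn; apply: le_trans (ler_wpM2r (sqr_ge0 _) h) _.
rewrite -mulrA -[(\tr G ^+ _) ^+ 2]exprM -exprS -exprM -expnSr muln2.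
rewrite [X in _ <= _ * _ ^+ X.-1]expnSr muln2.
by case: (2 ^ q.+1)%N p0.
Qed.

(** Apply positivity to c_j e_i - c_i e_j to bound the off-diagonal entries by
    the diagonal ones. *)
Lemma psd_form_le_trace G c : G^T = G -> psd G ->
  (c *m G *m c^T) 0 0 <= (\sum_i c 0 i ^+ 2) * \tr G.
Proof.
move=> Gs Gpsd.
have Gij i j : G j i = G i j by rewrite -[in LHS]Gs mxE.
have formE (a : 'rV[R]_n) : (a *m G *m a^T) 0 0 =
    \sum_i \sum_j a 0 i * a 0 j * G i j.
  rewrite mxE exchange_big /=; apply: eq_bigr => j _; rewrite !mxE mulr_suml.
  by apply: eq_bigr => i _; ring.
have key i j : 2 * (c 0 i * c 0 j * G i j) <= c 0 i ^+ 2 * G j j + c 0 j ^+ 2 * G i i.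
  have := Gpsd (c 0 j *: delta_mx 0 i - c 0 i *: delta_mx 0 j).
  rewrite [(_ - _)^T]linearB /= ![(_ *: _)^T]linearZ /= !(mulmxBl, mulmxBr) -!(scalemxAl, scalemxAr).
  rewrite !trmx_delta -!rowE -!colE !mxE Gij; nra.
rewrite formE mulr_suml -(ler_pM2l (ltr0n R 2)) mulr_sumr.
apply: (@le_trans _ _ (\sum_i \sum_j (c 0 i ^+ 2 * G j j + c 0 j ^+ 2 * G i i))).
  by apply: ler_sum => i _; rewrite mulr_sumr; apply: ler_sum => j _; exact: key.
under eq_bigr do rewrite big_split /=.
rewrite big_split /= [X in _ + X]exchange_big /= mulr2n mulrDl mul1r.
rewrite le_eqVlt; apply/orP; left; apply/eqP; congr (_ + _).
  by apply: eq_bigr => i _; rewrite -mulr_sumr.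
by apply: eq_bigr => i _; rewrite -mulr_sumr.
Qed.

Lemma psd_trace_mul_sq Y G : Y^T = Y -> G^T = G -> psd G ->
  \tr (Y ^+ 2 *m G) <= \tr (Y ^+ 2) * \tr G.
Proof.
move=> Ys Gs Gpsd.
have -> : \tr (Y ^+ 2 *m G) = \tr (Y *m G *m Y^T).
  by rewrite Ys [RHS]mxtrace_mulC mulmxA -[Y *m Y]/(Y * Y) -expr2.
have -> : \tr (Y ^+ 2) = \sum_i \sum_j row i Y 0 j ^+ 2.
  rewrite expr2 /mxtrace; apply: eq_bigr => i _; rewrite mxE.
  by apply: eq_bigr => j _; rewrite mxE -[in Y j i]Ys mxE -expr2.
rewrite mulr_suml; apply: ler_sum => i _.
apply: le_trans (psd_form_le_trace (row i Y) Gs Gpsd).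
rewrite -row_mul !mxE le_eqVlt; apply/orP; left; apply/eqP/eq_bigr => j _.
by rewrite !mxE.
Qed.

(** With G the Gram matrix of vectors f_x, tr (Y G) is the sum of
    Y_xy <f_x, f_y> and tr G is the sum of |f_x|^2: a bound on a high moment of Y
    controls the quadratic form of Y on functions with values in any inner
    product space. *)
Theorem psd_trace_moment Y G q : Y^T = Y -> G^T = G -> psd G ->
  \tr (Y *m G) ^+ (2 ^ q.+1) <= \tr (Y ^+ (2 ^ q.+1)) * \tr G ^+ (2 ^ q.+1).
Proof.
move=> Ys Gs Gpsd; apply: le_trans (psd_trace_pow q Ys Gs Gpsd) _.
have trG0 : 0 <= \tr G.
  by have := psd_trace_ge0 1%:M Gpsd; rewrite mul1mx trmx1 mulmx1.
have e : (2 ^ q.+1 = (2 ^ q.+1).-1.+1)%N by rewrite prednK// expn_gt0.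
rewrite [X in _ <= _ * _ ^+ X]e exprS mulrA; apply: ler_wpM2r; first exact: exprn_ge0.
by rewrite expnSr exprM; apply: psd_trace_mul_sq => //; exact: trmx_exp.
Qed.
End PsdTrace.

(** * Averages over finite types *)

Section Average.
Variable R : realFieldType.
Implicit Types T : finType.

Definition avg T (F : T -> R) : R := (\sum_t F t) / #|T|%:R.

Lemma eq_avg T (F G : T -> R) : F =1 G -> avg F = avg G.
Proof. by move=> FG; rewrite /avg (eq_bigr G). Qed.

Lemma le_avg T (F G : T -> R) : (forall t, F t <= G t) -> avg F <= avg G.
Proof. by move=> FG; rewrite ler_wpM2r ?invr_ge0// ler_sum. Qed.

Lemma avg_ge0 T (F : T -> R) : (forall t, 0 <= F t) -> 0 <= avg F.
Proof. by move=> F0; rewrite divr_ge0 ?sumr_ge0. Qed.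

Lemma avg_const T (c : R) : (0 < #|T|)%N -> avg (fun _ : T => c) = c.
Proof.
by move=> T0; rewrite /avg sumr_const -[_ *+ #|_|]mulr_natr mulfK// pnatr_eq0 -lt0n.
Qed.

Lemma avgD T (F G : T -> R) : avg (fun t => F t + G t) = avg F + avg G.
Proof. by rewrite /avg big_split mulrDl. Qed.

Lemma avgB T (F G : T -> R) : avg (fun t => F t - G t) = avg F - avg G.
Proof. by rewrite /avg sumrB mulrBl. Qed.

Lemma avgZ T (c : R) (F : T -> R) : avg (fun t => c * F t) = c * avg F.
Proof. by rewrite /avg -mulr_sumr mulrA. Qed.

Lemma avg_sum T (I : finType) (F : I -> T -> R) :
  avg (fun t => \sum_i F i t) = \sum_i avg (F i).
Proof. by rewrite /avg exchange_big /= mulr_suml. Qed.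

Lemma avg_exchange T T' (F : T -> T' -> R) :
  avg (fun t => avg (F t)) = avg (fun t' => avg (F^~ t')).
Proof.
rewrite /avg -!mulr_suml exchange_big /=.
by rewrite -!mulrA [_^-1 * _]mulrC.
Qed.

Lemma avg_reindex T (h : T -> T) (F : T -> R) :
  injective h -> avg (F \o h) = avg F.
Proof. by move=> h_inj; rewrite /avg [in RHS](reindex_inj h_inj). Qed.

Lemma avg_prod_ffun (I T : finType) (F : I -> T -> R) :
  avg (fun w : {ffun I -> T} => \prod_i F i (w i)) = \prod_i avg (F i).
Proof.
by rewrite /avg -bigA_distr_bigA /= card_ffun natrX big_split /= prodr_const exprVn.
Qed.

Lemma avg_sqr_le T (F : T -> R) : (0 < #|T|)%N ->
  avg F ^+ 2 <= avg (fun t => F t ^+ 2).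
Proof.
move=> T0; have : 0 <= avg (fun t => (F t - avg F) ^+ 2).
  by apply: avg_ge0 => t; rewrite sqr_ge0.
have e t : (F t - avg F) ^+ 2 = F t ^+ 2 + (- 2 * avg F * F t + avg F ^+ 2) by ring.
rewrite (eq_avg e) avgD avgD avg_const// avgZ => h.
rewrite -subr_ge0; apply: le_trans h _.
by rewrite le_eqVlt; apply/orP; left; apply/eqP; ring.
Qed.

Lemma avg_pow_le T (F : T -> R) q : (0 < #|T|)%N ->
  avg F ^+ (2 ^ q.+1) <= avg (fun t => F t ^+ (2 ^ q.+1)).
Proof.
move=> T0; elim: q => [|q IH]; first exact: avg_sqr_le.
rewrite [(2 ^ q.+2)%N]expnSr exprM.
apply: (@le_trans _ _ (avg (fun t => F t ^+ (2 ^ q.+1)) ^+ 2)).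
  rewrite lerXn2r ?nnegrE//; first by rewrite expnSr exprM sqr_ge0.
  by apply: avg_ge0 => t; rewrite expnSr exprM sqr_ge0.
by apply: le_trans (avg_sqr_le _ T0) _; apply: le_avg => t; rewrite -exprM.
Qed.

Lemma avg_markov T (F : T -> R) (B : pred T) (theta M : R) :
  (forall t, 0 <= F t) -> 0 < theta -> (forall t, B t -> theta <= F t) ->
  avg F <= M -> avg (fun t => (B t)%:R) <= M / theta.
Proof.
move=> F0 theta0 BF FM; rewrite ler_pdivlMr// mulrC; apply: le_trans FM.
rewrite -avgZ; apply: le_avg => t.
by case: (boolP (B t)) => [/BF|_]; rewrite ?mulr1// mulr0.
Qed.

End Average.

(** * Moments of randomly signed sums of matrices *)

Section SignedWalks.
Variables (R : realFieldType) (I : finType) (n : nat).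
Variables (Z : I -> 'M[R]_n) (c D s : R) (P : nat).
Hypotheses (D0 : 0 < D) (s0 : 0 < s) (cPDs : c * P%:R * D <= s ^+ 2).
Hypothesis (c0 : 0 <= c).
Hypothesis (Zrow : forall t x, \sum_y `|Z t x y| <= c).
Hypothesis (Ztot : forall x, \sum_t \sum_y `|Z t x y| <= D).
Implicit Types (eps : {ffun I -> bool}) (O : {set I}).

Definition signed_sum eps : 'M[R]_n := \sum_t (-1) ^+ eps t *: Z t.

Definition set_sign O eps : R := \prod_(t in O) (-1) ^+ eps t.

(** Symmetric difference with a singleton. *)
Definition toggle O t := if t \in O then O :\ t else t |: O.

Lemma set_sign_toggle O t eps :
  set_sign O eps * (-1) ^+ eps t = set_sign (toggle O t) eps.
Proof.
rewrite /set_sign /toggle; case: ifPn => tO; last by rewrite big_setU1//= mulrC.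
rewrite (big_setD1 t tO) /= [(-1) ^+ _ * _]mulrC -mulrA -expr2.
by rewrite sqrr_sign mulr1.
Qed.

Lemma avg_set_sign O : avg (set_sign O) = (O == finset.set0)%:R.
Proof.
have -> : avg (set_sign O) =
   avg (fun eps : {ffun I -> bool} => \prod_t (if t \in O then (-1) ^+ eps t else 1)).
  by apply: eq_avg => eps; rewrite /set_sign big_mkcond.
rewrite (avg_prod_ffun (fun t b => if t \in O then (-1) ^+ (nat_of_bool b) else 1)).
have [->|[t tO]] := set_0Vmem O.
  rewrite eqxx; apply: big1 => t _; rewrite inE avg_const//.
  by rewrite card_bool.
rewrite (bigD1 t)//= tO.
have -> : (O == finset.set0) = false by apply/negP => /eqP O0; rewrite O0 inE in tO.
by rewrite /avg big_bool /= expr1 expr0 addNr !mul0r.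
Qed.

Definition walk_moment r O x z : R :=
  avg (fun eps => set_sign O eps * (signed_sum eps ^+ r) x z).

(** Expanding one factor of the power multiplies the sign of O by one more sign,
    which cancels when that label is already in O. *)
Lemma walk_momentS r O x z : walk_moment r.+1 O x z =
  \sum_t \sum_y Z t x y * walk_moment r (toggle O t) y z.
Proof.
rewrite /walk_moment; under [RHS]eq_bigr do under eq_bigr do rewrite -avgZ.
under [RHS]eq_bigr do rewrite -avg_sum.
rewrite -avg_sum; apply: eq_avg => eps.
rewrite exprS mxE [in LHS]/signed_sum.
under eq_bigr do rewrite summxE mulr_suml.
rewrite exchange_big /= mulr_sumr; apply: eq_bigr => t _.
rewrite mulr_sumr; apply: eq_bigr => y _.
by rewrite mxE -set_sign_toggle; ring.
Qed.

(** O is the set of labels seen an odd number of times so far.  The next step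
    either opens a new label, with total weight at most D, or closes one of the at
    most P open labels, with weight at most c each.  The weight (s / D)^#|O|
    balances the two contributions, both at most s, when c P D <= s^2. *)
Lemma walk_moment_le r O x z : (r + #|O| <= P)%N ->
  `|walk_moment r O x z| <= (2 * s) ^+ r * (s / D) ^+ #|O|.
Proof.
have a0 : 0 < s / D by rewrite divr_gt0.
have aX i : 0 <= (s / D) ^+ i by rewrite exprn_ge0// ltW.
have bX i : 0 <= (2 * s) ^+ i by rewrite exprn_ge0// mulr_ge0// ltW.
elim: r O x z => [|r IH] O x z rP.
  rewrite expr0 mul1r /walk_moment.
  under eq_avg do rewrite expr0 mxE mulrC.
  rewrite avgZ avg_set_sign; have [->|_] := eqVneq O finset.set0.
    by rewrite cards0 expr0 mulr1; case: (x == z); rewrite ?normr1// normr0 ler01.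
  by rewrite mulr0 normr0 exprn_ge0// ltW.
rewrite walk_momentS; apply: le_trans (ler_norm_sum _ _ _) _.
pose h t : R := \sum_y `|Z t x y|.
have h0 t : 0 <= h t by apply: sumr_ge0.
apply: (@le_trans _ _ (\sum_t h t * ((2 * s) ^+ r * (s / D) ^+ #|toggle O t|))).
  apply: ler_sum => t _; apply: le_trans (ler_norm_sum _ _ _) _.
  rewrite /h mulr_suml; apply: ler_sum => y _; rewrite normrM ler_wpM2l//.
  apply: IH; apply: leq_trans rP; rewrite addSn -addnS leq_add2l /toggle.
  case: ifPn => tO; first by rewrite (leq_trans (subset_leq_card (subD1set _ _))).
  by rewrite cardsU1 tO.
pose b := (2 * s) ^+ r * (s / D) ^+ #|O|.
have b0 : 0 <= b by rewrite mulr_ge0.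
have -> : (2 * s) ^+ r.+1 * (s / D) ^+ #|O| = b * s + b * s by rewrite exprS /b; ring.
rewrite (bigID (mem O)) /=; apply: lerD.
  have [->|On0] := eqVneq O finset.set0.
    by rewrite big_pred0 ?mulr_ge0// ?ltW// => t; rewrite inE.
  have e : (s / D) ^+ #|O| = (s / D) * (s / D) ^+ #|O|.-1.
    by rewrite -exprS prednK// card_gt0.
  apply: (@le_trans _ _ (\sum_(t in O) c * ((2 * s) ^+ r * (s / D) ^+ #|O|.-1))).
    apply: ler_sum => t tO; rewrite /toggle tO [in leRHS](cardsD1 t) tO add1n /=.
    by apply: ler_wpM2r; [exact: mulr_ge0 | exact: Zrow].
  rewrite sumr_const -[_ *+ #|_|]mulr_natl mulrA.
  have -> : b * s = (s ^+ 2 / D) * ((2 * s) ^+ r * (s / D) ^+ #|O|.-1).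
    by rewrite /b e; ring.
  apply: ler_wpM2r; first by rewrite mulr_ge0.
  rewrite ler_pdivlMr//; apply: le_trans cPDs.
  rewrite [_ * c]mulrC; apply: (ler_wpM2r (ltW D0)); rewrite ler_wpM2l// ler_nat.
  by apply: leq_trans rP; rewrite leq_addl.
apply: (@le_trans _ _ (\sum_(t | t \notin O) h t * (b * (s / D)))).
  apply: ler_sum => t tO; rewrite /toggle (negbTE tO) cardsU1 tO add1n exprS.
  by rewrite /b ler_wpM2l// le_eqVlt; apply/orP; left; apply/eqP; ring.
rewrite -mulr_suml; apply: (@le_trans _ _ (D * (b * (s / D)))).
  apply: ler_wpM2r; first by rewrite mulr_ge0// ltW.
  apply: le_trans (Ztot x); rewrite [leRHS](bigID (mem O)) /= lerDr.
  by apply: sumr_ge0 => t _; exact: h0.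
by rewrite le_eqVlt; apply/orP; left; apply/eqP; field; rewrite gt_eqF.
Qed.

(** For bounded c, a signed sum of matrices whose row sums add up to D is thus of
    size sqrt (P D) up to constants, when measured by its P-th moment, instead of
    D. *)
Lemma signed_trace_le : avg (fun eps => \tr (signed_sum eps ^+ P)) <= n%:R * (2 * s) ^+ P.
Proof.
rewrite /mxtrace avg_sum; apply: (@le_trans _ _ (\sum_(i < n) (2 * s) ^+ P)).
  apply: ler_sum => i _.
  have := @walk_moment_le P finset.set0 i i; rewrite cards0 addn0 expr0 mulr1 => /(_ (leqnn _)).
  apply: le_trans; apply: le_trans (ler_norm _) _.
  rewrite /walk_moment; under [in leRHS]eq_avg do rewrite /set_sign big_set0 mul1r.
  by [].
by rewrite sumr_const card_ord [n%:R * _]mulr_natl.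
Qed.
End SignedWalks.

(** * Concentration of a sum of independent random matrices *)

Section Concentration.
Variable R : realType.

Lemma expR_le_1D2x (x : R) : 0 <= x <= 1 / 2 -> expR x <= 1 + 2 * x.
Proof.
move=> /andP[x0 x1]; have h := expR_ge1Dx (- x).
have e : expR x = (expR (- x))^-1 by rewrite expRN invrK.
have h1 : 0 < 1 - x by lra.
rewrite e; apply: (@le_trans _ _ (1 - x)^-1).
  by rewrite lef_pV2 ?posrE ?expR_gt0.
by rewrite -[leLHS]mul1r ler_pdivrMr//; nra.
Qed.

Lemma expRN_le_1Bx2 (x : R) : 0 <= x <= 1 -> expR (- x) <= 1 - x / 2.
Proof.
move=> /andP[x0 x1]; have h := expR_ge1Dx x.
rewrite expRN; apply: (@le_trans _ _ (1 + x)^-1).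
  by rewrite lef_pV2 ?posrE ?expR_gt0//; lra.
have h1 : 0 < 1 + x by lra.
by rewrite -[leLHS]mul1r ler_pdivrMr//; nra.
Qed.

Lemma avg_pair (T T' : finType) (F : T -> T' -> R) :
  avg (fun p : T * T' => F p.1 p.2) = avg (fun t => avg (F t)).
Proof.
rewrite /avg -mulr_suml -mulrA -invfM card_prod natrM mulrC [in RHS]mulrC.
by rewrite [in RHS]pair_big /= [in RHS]mulrC [in LHS]mulrC [(_ * #|T|%:R)]mulrC.
Qed.

(** The factor 16^2 comes from the threshold delta / 16 in the definition of good
    samples, the factor 32 from the signed walks and expR 4 from the exponential
    moment of the degrees. *)
Definition moment_const : R := 16 ^+ 2 * (32 * expR 4).

Lemma moment_const_ge8 : 8 <= moment_const.
Proof.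
have e4 : 1 <= expR 4 :> R by apply: le_trans (expR_ge1Dx _); lra.
by rewrite /moment_const; nra.
Qed.

Variables (Om : finType) (n : nat) (A : Om -> 'M[R]_n) (mu : R) (N : nat).
Hypothesis Om0 : (0 < #|Om|)%N.
Hypothesis n0 : (0 < n)%N.
Hypothesis Asym : forall o, (A o)^T = A o.
Hypothesis Age0 : forall o x y, 0 <= A o x y.
Let h o x : R := \sum_y A o x y.
Hypothesis hle2 : forall o x, h o x <= 2.
Hypothesis avgh : forall x, avg (h^~ x) = mu.
Let delta : R := N%:R * mu.
Implicit Types w : {ffun 'I_N -> Om}.

Definition sample_sum w : 'M[R]_n := \sum_t A (w t).

Definition mean_mx : 'M[R]_n := \matrix_(x, y) avg (fun o => A o x y).

(** Besides the lower bound on the degrees, the second condition averages over an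
    independent sample w' instead of subtracting the mean: this is a condition on
    traces alone, which can be symmetrized. *)
Definition good_sample q w :=
  [forall x, delta / 4 <= \sum_y sample_sum w x y] &&
  (avg (fun w' => \tr ((sample_sum w - sample_sum w') ^+ (2 ^ q.+1)))
     <= (delta / 16) ^+ (2 ^ q.+1)).

Let sumc (y : R) : n%:R * y = \sum_(x < n) y.
Proof. by rewrite sumr_const card_ord [n%:R * _]mulr_natl. Qed.

Let h0 o x : 0 <= h o x. Proof. exact: sumr_ge0. Qed.

Let mu0 : 0 <= mu.
Proof. by rewrite -(avgh (Ordinal n0)); apply: avg_ge0. Qed.

Let delta0 : 0 <= delta. Proof. by rewrite mulr_ge0. Qed.

Lemma sample_sum_sym w : (sample_sum w)^T = sample_sum w.
Proof. by rewrite /sample_sum linear_sum; apply: eq_bigr => t _; exact: Asym. Qed.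

Lemma sample_sum_row w x : \sum_y sample_sum w x y = \sum_t h (w t) x.
Proof. by rewrite exchange_big /=; apply: eq_bigr => y _; rewrite summxE. Qed.

Lemma sample_space_gt0 : (0 < #|{ffun 'I_N -> Om}|)%N.
Proof. by rewrite card_ffun expn_gt0 Om0. Qed.

Lemma avg_coord (t : 'I_N) (F : Om -> R) :
  avg (fun w : {ffun 'I_N -> Om} => F (w t)) = avg F.
Proof.
have -> : avg (fun w : {ffun 'I_N -> Om} => F (w t)) =
  avg (fun w : {ffun 'I_N -> Om} => \prod_i (if i == t then F (w i) else 1)).
  apply: eq_avg => w; rewrite (bigD1 t)//= eqxx big1 ?mulr1// => i.
  by move=> /negbTE ->.
rewrite (avg_prod_ffun (fun i o => if i == t then F o else 1)) (bigD1 t)//= eqxx.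
by rewrite big1 ?mulr1// => i /negbTE ->; rewrite avg_const.
Qed.

Lemma avg_sample_sum (G : 'M[R]_n) :
  avg (fun w => \tr (sample_sum w *m G)) = N%:R * \tr (mean_mx *m G).
Proof.
rewrite /sample_sum; under eq_avg do rewrite mulmx_suml linear_sum.
rewrite avg_sum.
under eq_bigr do rewrite (avg_coord _ (fun o => \tr (A o *m G))).
rewrite sumr_const card_ord mulr_natl; congr (_ *+ _).
rewrite {1}/mxtrace avg_sum; apply: eq_bigr => x _; rewrite mxE.
under eq_avg do rewrite mxE.
rewrite avg_sum; apply: eq_bigr => y _; rewrite mxE mulrC -avgZ.
by apply: eq_avg => o; rewrite mulrC.
Qed.

(** Averaging over w' replaces sample_sum w' by its mean; by convexity the power of
    the average is at most the average of the powers. *)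
Lemma good_sample_form q w (G : 'M[R]_n) : good_sample q w -> G^T = G -> psd G ->
  `|\tr (sample_sum w *m G) - N%:R * \tr (mean_mx *m G)| <= delta / 16 * \tr G.
Proof.
move=> /andP[_ good] Gs Gpsd.
have trG0 : 0 <= \tr G.
  by have := psd_trace_ge0 1%:M Gpsd; rewrite mul1mx trmx1 mulmx1.
pose F w' := \tr ((sample_sum w - sample_sum w') *m G).
have <- : avg F = \tr (sample_sum w *m G) - N%:R * \tr (mean_mx *m G).
  rewrite -avg_sample_sum -[X in X - _](avg_const _ sample_space_gt0) -avgB.
  by apply: eq_avg => w'; rewrite /F mulmxBl linearB.
have p0 : (0 < 2 ^ q.+1)%N by rewrite expn_gt0.
rewrite -(ler_pXn2r p0) ?nnegrE ?mulr_ge0 ?invr_ge0//.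
rewrite -normrX ger0_norm; last by rewrite expnSr exprM sqr_ge0.
apply: le_trans (avg_pow_le _ _ sample_space_gt0) _.
rewrite exprMn; apply: le_trans (ler_wpM2r (exprn_ge0 _ trG0) good).
rewrite mulrC -avgZ; apply: le_avg => w'; rewrite mulrC.
by apply: psd_trace_moment => //; rewrite linearB /= !sample_sum_sym.
Qed.

(** Chernoff bound with the exponential moment of - degree / 2. *)
Lemma low_degree_prob x :
  avg (fun w => (\sum_y sample_sum w x y < delta / 4)%R%:R : R) <= expR (- delta / 8).
Proof.
have -> : expR (- delta / 8) = expR (- delta / 4) / expR (- delta / 8).
  by rewrite -expRN -expRD; congr expR; field.
apply: (@avg_markov _ _ (fun w => expR (- (\sum_y sample_sum w x y) / 2))).
- by move=> w; exact: expR_ge0.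
- exact: expR_gt0.
- by move=> w; rewrite ler_expR; lra.
under eq_avg => w do rewrite sample_sum_row -sumrN mulr_suml expR_sum.
rewrite (avg_prod_ffun (fun _ o => expR (- h o x / 2))) prodr_const card_ord.
have -> : expR (- delta / 4) = expR (- mu / 4) ^+ N.
  by rewrite -expRM_natl; congr expR; rewrite /delta; ring.
apply: lerXn2r; rewrite ?nnegrE ?expR_ge0//.
  by apply: avg_ge0 => o; exact: expR_ge0.
apply: (@le_trans _ _ (avg (fun o => 1 - 4^-1 * h o x))).
  apply: le_avg => o.
  have := @expRN_le_1Bx2 (h o x / 2).
  have := h0 o x; have := hle2 o x => h1 h2.
  have -> : 0 <= h o x / 2 <= 1 by apply/andP; split; lra.
  rewrite mulNr => /(_ isT) h3; apply: le_trans h3 _; lra.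
rewrite avgB avg_const// avgZ avgh.
by apply: le_trans (expR_ge1Dx _); lra.
Qed.

Let p2 q := (2 ^ q)%N.

Let tot (p : {ffun 'I_N -> Om} * {ffun 'I_N -> Om}) x : R :=
  \sum_t (h (p.1 t) x + h (p.2 t) x).

(** Use 1 + d <= delta exp (d / delta), whose power p2 q is an exponential moment
    with the small parameter p2 q / delta, and independence. *)
Lemma avg_total_degree_pow q x : 1 <= delta -> 4 * (p2 q)%:R <= delta ->
  avg (fun p => (1 + tot p x) ^+ p2 q) <= (delta * expR 4) ^+ p2 q.
Proof.
move=> d1 dp; have dgt0 : 0 < delta by lra.
pose th := (p2 q)%:R / delta.
have th0 : 0 <= th by rewrite divr_ge0.
have th4 : th <= 1 / 4 by rewrite /th ler_pdivrMr//; lra.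
pose E o := expR (th * h o x).
have step p : (1 + tot p x) ^+ p2 q <=
    delta ^+ p2 q * ((\prod_t E (p.1 t)) * \prod_t E (p.2 t)).
  have tot0 : 0 <= tot p x by apply: sumr_ge0 => t _; rewrite addr_ge0.
  apply: (@le_trans _ _ ((delta * expR (tot p x / delta)) ^+ p2 q)).
    apply: lerXn2r; rewrite ?nnegrE ?mulr_ge0 ?addr_ge0 ?expR_ge0//.
    apply: (@le_trans _ _ (delta * (1 + tot p x / delta))).
      by rewrite mulrDr mulr1 mulrCA divff ?gt_eqF// mulr1 lerD2r.
    by rewrite ler_pM2l// expR_ge1Dx.
  rewrite [leLHS]exprMn ler_pM2l ?exprn_gt0// -expRM_natl.
  rewrite le_eqVlt; apply/orP; left; apply/eqP.
  rewrite -!expR_sum -expRD -big_split /=; congr expR.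
  rewrite mulrCA mulrC -/th /tot mulr_sumr.
  by apply: eq_bigr => t _; rewrite mulrDr.
apply: le_trans (le_avg step) _.
rewrite avgZ [leRHS]exprMn ler_pM2l ?exprn_gt0//.
rewrite (avg_pair (fun w w' : {ffun 'I_N -> Om} => (\prod_t E (w t)) * \prod_t E (w' t))).
under eq_avg do rewrite avgZ mulrC.
rewrite avgZ (avg_prod_ffun (fun _ => E)) prodr_const card_ord.
have -> : expR 4 ^+ p2 q = expR (2 * th * mu) ^+ N * expR (2 * th * mu) ^+ N :> R.
  rewrite -!expRM_natl -expRD; congr expR.
  have -> : N%:R * (2 * th * mu) = 2 * (th * delta) by rewrite /delta; ring.
  by rewrite /th divfK ?gt_eqF//; ring.
have E0 : 0 <= avg E by apply: avg_ge0 => o; exact: expR_ge0.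
have Ele : avg E <= expR (2 * th * mu).
  apply: (@le_trans _ _ (avg (fun o => 1 + 2 * th * h o x))).
    apply: le_avg => o; rewrite /E -mulrA; apply: expR_le_1D2x.
    have := h0 o x; have := hle2 o x => h1 h2.
    by apply/andP; split; nra.
  by rewrite avgD avg_const// avgZ avgh expR_ge1Dx.
by apply: ler_pM; rewrite ?exprn_ge0// lerXn2r ?nnegrE ?expR_ge0.
Qed.

(** The bound on walks needs the largest degree; its power is at most the sum of
    the powers of all degrees, which can be averaged. *)
Lemma signed_sample_trace q (p : {ffun 'I_N -> Om} * {ffun 'I_N -> Om}) :
  avg (fun eps => \tr (signed_sum (fun t => A (p.1 t) - A (p.2 t)) eps ^+ (2 ^ q.+1)))
  <= n%:R * \sum_x (32 * (p2 q)%:R * (1 + tot p x)) ^+ p2 q.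
Proof.
pose x1 := [arg max_(x > Ordinal n0) tot p x]%O.
have x1max x : tot p x <= tot p x1.
  by rewrite /x1; case: Order.TotalTheory.arg_maxP => // i _; apply.
pose D := 1 + tot p x1; pose s := Num.sqrt (8 * (p2 q)%:R * D).
have tot0 x : 0 <= tot p x by apply: sumr_ge0 => t _; rewrite addr_ge0.
have D0 : 0 < D by rewrite ltr_pwDl.
have p0 : 0 < (p2 q)%:R :> R by rewrite ltr0n expn_gt0.
have s0 : 0 < s by rewrite sqrtr_gt0 !mulr_gt0.
have s2 : s ^+ 2 = 8 * (p2 q)%:R * D by rewrite sqr_sqrtr// !mulr_ge0// ltW.
have Zle t x : \sum_y `|(A (p.1 t) - A (p.2 t)) x y| <= h (p.1 t) x + h (p.2 t) x.
  rewrite /h -big_split /=; apply: ler_sum => y _; rewrite !mxE.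
  by apply: le_trans (ler_normB _ _) _; rewrite !ger0_norm.
apply: (@le_trans _ _ (n%:R * (2 * s) ^+ (2 ^ q.+1))).
  apply: (@signed_trace_le _ _ _ _ 4 D) => //.
  - by rewrite s2 expnS natrM -/(p2 q); lra.
  - move=> t x; apply: le_trans (Zle t x) _.
    by have := hle2 (p.1 t) x; have := hle2 (p.2 t) x; lra.
  - move=> x; apply: le_trans (ler_sum _ (fun t _ => Zle t x)) _.
    by apply: le_trans (x1max x) _; rewrite lerDr.
rewrite ler_wpM2l// expnS exprM [(2 * s) ^+ 2]exprMn s2 (bigD1 x1)//=.
have -> : 2 ^+ 2 * (8 * (p2 q)%:R * D) = 32 * (p2 q)%:R * (1 + tot p x1) by rewrite /D; ring.
rewrite lerDl; apply: sumr_ge0 => x _; rewrite exprn_ge0// !mulr_ge0// ?addr_ge0//.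
Qed.

(** Exchanging w and w' at any set of indices preserves the average, so random
    signs may be introduced in sample_sum w - sample_sum w'. *)
Lemma avg_trace_moment q : 1 <= delta -> 4 * (p2 q)%:R <= delta ->
  avg (fun w => avg (fun w' => \tr ((sample_sum w - sample_sum w') ^+ (2 ^ q.+1))))
  <= n%:R ^+ 2 * (32 * expR 4 * (p2 q)%:R * delta) ^+ p2 q.
Proof.
move=> d1 dp.
rewrite -(avg_pair (fun w w' => \tr ((sample_sum w - sample_sum w') ^+ (2 ^ q.+1)))).
pose T (p : {ffun 'I_N -> Om} * {ffun 'I_N -> Om}) :=
  \tr ((sample_sum p.1 - sample_sum p.2) ^+ (2 ^ q.+1)).
pose swap (eps : {ffun 'I_N -> bool}) (p : {ffun 'I_N -> Om} * {ffun 'I_N -> Om}) :=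
  ([ffun t => if eps t then p.2 t else p.1 t],
   [ffun t => if eps t then p.1 t else p.2 t]).
have swapK eps : involutive (swap eps).
  by case=> w w'; congr pair; apply/ffunP => t; rewrite !ffunE /=; case: (eps t);
    rewrite ?ffunE; case: (eps t).
have swapT eps p : T (swap eps p) =
    \tr (signed_sum (fun t => A (p.1 t) - A (p.2 t)) eps ^+ (2 ^ q.+1)).
  congr (\tr (_ ^+ _)); rewrite /sample_sum /signed_sum -sumrB.
  apply: eq_bigr => t _; rewrite !ffunE; case: (eps t); rewrite ?expr1 ?expr0.
    by rewrite scaleN1r opprB.
  by rewrite scale1r.
have -> : avg (fun p => T p) = avg (fun p => avg (fun eps => T (swap eps p))).
  rewrite avg_exchange -[LHS](@avg_const _ {ffun 'I_N -> bool}); last first.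
    by rewrite card_ffun card_bool expn_gt0.
  by apply: eq_avg => eps; rewrite -(avg_reindex _ (inv_inj (swapK eps))).
apply: (@le_trans _ _ (avg (fun p =>
   n%:R * \sum_x (32 * (p2 q)%:R * (1 + tot p x)) ^+ p2 q))).
  apply: le_avg => p; apply: le_trans (signed_sample_trace q p).
  by apply: le_avg => eps; rewrite swapT.
rewrite avgZ expr2 -mulrA ler_wpM2l// avg_sum.
rewrite sumc; apply: ler_sum => x _.
under eq_avg do rewrite exprMn.
rewrite avgZ (_ : 32 * expR 4 * _ * _ = 32 * (p2 q)%:R * (delta * expR 4)); last by ring.
rewrite [leRHS]exprMn ler_wpM2l ?exprn_ge0 ?mulr_ge0//.
exact: avg_total_degree_pow.
Qed.

(** Union bound over the degrees, and Markov's inequality for the trace. *)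
Theorem bad_sample_prob q : 1 <= delta -> 4 * (2 ^ q)%:R <= delta ->
  avg (fun w => (~~ good_sample q w)%:R : R) <=
  n%:R * expR (- delta / 8) +
  n%:R ^+ 2 * (moment_const * (2 ^ q)%:R / delta) ^+ (2 ^ q).
Proof.
move=> d1 dp; have dgt0 : 0 < delta by lra.
pose low x w := \sum_y sample_sum w x y < delta / 4.
pose T w := avg (fun w' => \tr ((sample_sum w - sample_sum w') ^+ (2 ^ q.+1))).
pose big w := (delta / 16) ^+ (2 ^ q.+1) < T w.
apply: (@le_trans _ _ (avg (fun w => (\sum_x (low x w)%:R) + (big w)%:R : R))).
  apply: le_avg => w; rewrite /good_sample negb_and negb_forall -ltNge.
  case: existsP => [[x]|_] /=; last by rewrite lerDr sumr_ge0.
  rewrite -ltNge => lowx; rewrite (bigD1 x)//= /low lowx -addrA lerDl.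
  by rewrite addr_ge0// sumr_ge0.
rewrite avgD avg_sum; apply: lerD.
  rewrite sumc; apply: ler_sum => x _.
  exact: low_degree_prob.
have T0 w : 0 <= T w.
  apply: avg_ge0 => w'; rewrite expnSr exprM.
  have := @psd_trace_ge0 _ n 1%:M ((sample_sum w - sample_sum w') ^+ (2 ^ q)).
  rewrite mulmx1 trmx_exp; last by rewrite linearB /= !sample_sum_sym.
  rewrite -[_ *m _]/(_ * _) -expr2; apply => c.
  by rewrite mulmx1 mxE; apply: sumr_ge0 => i _; rewrite !mxE -expr2 sqr_ge0.
have th0 : 0 < (delta / 16) ^+ (2 ^ q.+1) by rewrite exprn_gt0// divr_gt0.
apply: le_trans (avg_markov T0 th0 _ (avg_trace_moment d1 dp)) _.
  by move=> w /ltW.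
rewrite -[leLHS]mulrA ler_wpM2l ?exprn_ge0// expnS exprM -exprVn -exprMn.
rewrite le_eqVlt; apply/orP; left; apply/eqP; congr (_ ^+ _).
by rewrite /p2 /moment_const; field; rewrite gt_eqF.
Qed.

End Concentration.

(** * The real inner product of a complex Hilbert space *)

Section RealInnerProduct.
Variables (R : realType) (H : completeNormedModType R[i]).
Variable dot : {dot H for Num.conj}.
Hypothesis dotH : hilbert dot.
Implicit Types (u v w : H) (r : R).

(** All estimates take place in the underlying real Hilbert space. *)
Definition rdot u v : R := complex.Re (dot u v).
Definition nrm v : R := complex.Re `|v|.

Lemma rdotDl u v w : rdot (u + v) w = rdot u w + rdot v w.
Proof. by rewrite /rdot linearDl raddfD. Qed.

Lemma rdotC u v : rdot u v = rdot v u.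
Proof.
rewrite /rdot hermC expr0 mul1r; apply: complexI.
by rewrite !complexRe Re_conj.
Qed.

Lemma rdotZl r u v : rdot (r%:C%C *: u) v = r * rdot u v.
Proof. by rewrite /rdot linearZl_LR /=; case: (dot u v) => a b /=; rewrite mul0r subr0. Qed.

Lemma nrmE v : `|v| = (nrm v)%:C%C.
Proof. by rewrite /nrm RRe_real// ger0_real. Qed.

Lemma nrm_ge0 v : 0 <= nrm v.
Proof. by rewrite -ler0c -nrmE. Qed.

Lemma rdotvv v : rdot v v = nrm v ^+ 2.
Proof. by rewrite /rdot dotH nrmE -rmorphXn. Qed.

Lemma nrmD u v : nrm (u + v) <= nrm u + nrm v.
Proof. by rewrite -lecR rmorphD /= -!nrmE ler_normD. Qed.

Lemma nrmN v : nrm (- v) = nrm v.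
Proof. by rewrite /nrm normrN. Qed.

Lemma nrmB u v : nrm (u - v) = nrm (v - u).
Proof. by rewrite -nrmN opprB. Qed.

Lemma nrm_eq0 v : nrm v = 0 -> v = 0.
Proof. by move=> e; apply: normr0_eq0; rewrite nrmE e. Qed.

Lemma nrm0 : nrm 0 = 0. Proof. by rewrite /nrm normr0. Qed.

Lemma nrmZ r v : nrm (r%:C%C *: v) = `|r| * nrm v.
Proof.
apply: complexI; rewrite -nrmE normrZ rmorphM /= -nrmE; congr (_ * _).
by rewrite normc_def /= expr0n addr0 sqrtr_sqr.
Qed.

Lemma rdotDr u v w : rdot u (v + w) = rdot u v + rdot u w.
Proof. by rewrite rdotC rdotDl !(rdotC u). Qed.

Lemma rdotZr r u v : rdot u (r%:C%C *: v) = r * rdot u v.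
Proof. by rewrite rdotC rdotZl rdotC. Qed.

Lemma rdotNl u v : rdot (- u) v = - rdot u v.
Proof.
by rewrite -[- u]scaleN1r (_ : -1 = (-1)%:C%C) ?rdotZl ?mulN1r// rmorphN1.
Qed.

Lemma rdotNr u v : rdot u (- v) = - rdot u v.
Proof. by rewrite rdotC rdotNl rdotC. Qed.

Lemma rdot0l v : rdot 0 v = 0.
Proof. by have := rdotZl 0 0 v; rewrite scaler0 mul0r. Qed.

Definition rdotE := (rdotDl, rdotDr, rdotNl, rdotNr, rdotZl, rdotZr).

Lemma rdot_suml (I : finType) (P : pred I) (f : I -> H) v :
  rdot (\sum_(i | P i) f i) v = \sum_(i | P i) rdot (f i) v.
Proof.
by apply: (big_morph (rdot^~ v)) => [u w|]; [exact: rdotDl | exact: rdot0l].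
Qed.

Lemma rdot_sumr (I : finType) (P : pred I) (f : I -> H) v :
  rdot v (\sum_(i | P i) f i) = \sum_(i | P i) rdot v (f i).
Proof. by rewrite rdotC rdot_suml; apply: eq_bigr => i _; rewrite rdotC. Qed.

Lemma geometric_small (c r eps : R) : 0 <= c -> 0 <= r -> r < 1 -> 0 < eps ->
  exists j, c * r ^+ j <= eps.
Proof.
move=> c0 r0 r1 eps0; have := cvg_expr (_ : `|r| < 1).
rewrite ger0_norm// => /(_ r1) /cvgrPdist_lt.
have c10 : 0 < c + 1 by rewrite ltr_wpDl.
move=> /(_ _ (divr_gt0 eps0 c10)) [j _ /(_ j (leqnn j))] /=.
rewrite sub0r normrN ger0_norm ?exprn_ge0// ltr_pdivlMr// => rj; exists j.
have := exprn_ge0 j r0; nra.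
Qed.

Lemma geometric_cvg (V : nat -> H) (c r : R) : 0 <= c -> 0 <= r -> r < 1 ->
  (forall j, nrm (V j.+1 - V j) <= c * r ^+ j) ->
  exists v, forall j, nrm (v - V j) <= c / (1 - r) * r ^+ j.
Proof.
move=> c0 r0 r1 step; have r10 : 0 < 1 - r by rewrite subr_gt0.
have cr0 : 0 <= c / (1 - r) by rewrite divr_ge0// ltW.
have tail j i : nrm (V (j + i)%N - V j) <= c / (1 - r) * r ^+ j.
  suff h : nrm (V (j + i)%N - V j) <= c / (1 - r) * r ^+ j * (1 - r ^+ i).
    apply: le_trans h _; rewrite -[leRHS]mulr1 ler_wpM2l//.
      by rewrite mulr_ge0// exprn_ge0.
    by rewrite lerBlDr lerDl exprn_ge0.
  elim: i => [|i IH]; first by rewrite addn0 subrr nrm0 expr0 subrr mulr0.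
  rewrite addnS -(subrKA (V (j + i)%N)); apply: le_trans (nrmD _ _) _.
  apply: le_trans (lerD (step _) IH) _.
  rewrite le_eqVlt; apply/orP; left; apply/eqP.
  by rewrite exprD exprS; field; rewrite gt_eqF.
have cV : cvgn V.
  apply/cauchy_cvgP/cauchy_exP => _/posnumP[e].
  have eR : (complex.Re e%:num)%:C%C = e%:num by rewrite RRe_real// gtr0_real.
  have e0 : 0 < complex.Re e%:num by rewrite -ltcR eR; exact: gt0.
  have ltr0Sn2 : 0 < 2 :> R by [].
  have [j hj] := geometric_small cr0 r0 r1 (divr_gt0 e0 ltr0Sn2).
  exists (V j); exists j => // i /= ji.
  rewrite -ball_normE /= distrC nrmE -eR ltcR.
  rewrite -(subnKC ji); apply: le_lt_trans (tail _ _) _.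
  by apply: le_lt_trans hj _; lra.
exists (limn V) => j.
apply/ler_addgt0Pr => e e0.
have /cvgrPdist_lt /(_ e%:C%C) := cV; rewrite ltcR => /(_ e0) [i _ hi].
have := hi (j + i)%N (leq_addl _ _); rewrite /= nrmE ltcR => h.
rewrite -(subrKA (V (j + i)%N)); apply: le_trans (nrmD _ _) _.
by rewrite addrC; apply: lerD; [exact: tail | exact: ltW].
Qed.

End RealInnerProduct.

(** * From a spectral gap to fixed vectors *)

Section SpectralGap.
Variables (R : realType) (H : completeNormedModType R[i]).
Variable dot : {dot H for Num.conj}.
Hypothesis dotH : hilbert dot.
Local Notation rdot := (rdot dot).
Variables (X : finType) (rho : X -> {linear H -> H}) (inv : X -> X).
Hypothesis X0 : (0 < #|X|)%N.
Hypothesis invK : involutive inv.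
Hypothesis rho_adj : forall x u v, rdot (rho x u) v = rdot u (rho (inv x) v).
Hypothesis rho_nrm : forall x v, nrm (rho x v) = nrm v.

Definition laplace v : H := (#|X|%:R^-1)%:C%C *: \sum_x (v - rho x v).
Definition energy v : R := rdot (laplace v) v.

Let c : R := #|X|%:R^-1.
Let c0 : 0 < c. Proof. by rewrite invr_gt0 ltr0n. Qed.
Let c1 (y : R) : c * \sum_(x : X) y = y.
Proof. by rewrite sumr_const -[_ *+ #|_|]mulr_natl mulKf// pnatr_eq0 -lt0n. Qed.

Lemma nrmB_sqr u v : nrm (u - v) ^+ 2 = nrm u ^+ 2 + nrm v ^+ 2 - 2 * rdot u v.
Proof.
by rewrite -!(rdotvv dotH) !(rdotE dot) (rdotC dot v u); ring.
Qed.

Lemma displacement_sqr x v : nrm (rho x v - v) ^+ 2 = 2 * rdot (v - rho x v) v.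
Proof.
by rewrite nrmB_sqr rho_nrm !(rdotE dot) (rdotvv dotH); ring.
Qed.

(** For unitary operators |gv - v|^2 = 2 Re <v - gv, v>. *)
Lemma energyE v : 2 * energy v = c * \sum_x nrm (rho x v - v) ^+ 2.
Proof.
rewrite /energy /laplace rdotZl rdot_suml mulrCA; congr (_ * _).
by rewrite mulr_sumr; apply: eq_bigr => x _; rewrite displacement_sqr.
Qed.

(** Convexity: laplace v is the average of the vectors v - gv. *)
Lemma laplace_sqr_le v : nrm (laplace v) ^+ 2 <= 2 * energy v.
Proof.
set m := laplace v.
have h : 0 <= c * \sum_x nrm ((v - rho x v) - m) ^+ 2.
  by apply: (mulr_ge0 (ltW c0)); apply: sumr_ge0 => x _; rewrite sqr_ge0.
rewrite -subr_ge0; apply: le_trans h _.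
under eq_bigr do rewrite nrmB_sqr nrmB.
rewrite sumrB big_split /= mulrBr mulrDr c1 -energyE -mulr_sumr.
have e : c * rdot (\sum_x (v - rho x v)) m = nrm m ^+ 2.
  by rewrite -rdotZl -(rdotvv dotH).
rewrite -rdot_suml [c * (2 * _)]mulrCA e.
by rewrite le_eqVlt; apply/orP; left; apply/eqP; ring.
Qed.

Lemma laplace_self u v : rdot (laplace u) v = rdot u (laplace v).
Proof.
rewrite /laplace rdotZl rdotZr rdot_suml rdot_sumr; congr (_ * _).
under eq_bigr do rewrite rdotDl rdotNl rho_adj.
under [RHS]eq_bigr do rewrite rdotDr rdotNr.
by rewrite !sumrB; congr (_ - _); rewrite [RHS](reindex_inj (inv_inj invK)).
Qed.

Lemma energy_le v : energy v <= 2 * nrm v ^+ 2.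
Proof.
have h : c * \sum_x nrm (rho x v - v) ^+ 2 <= 4 * nrm v ^+ 2.
  rewrite -[leRHS]c1; apply: (ler_wpM2l (ltW c0)).
  apply: ler_sum => x _; apply: (@le_trans _ _ ((2 * nrm v) ^+ 2)); last first.
    by rewrite le_eqVlt; apply/orP; left; apply/eqP; ring.
  rewrite lerXn2r ?nnegrE ?nrm_ge0 ?mulr_ge0 ?nrm_ge0//.
  by apply: le_trans (nrmD _ _) _; rewrite nrmN rho_nrm mulr2n mulrDl mul1r.
by rewrite -energyE in h; lra.
Qed.

Lemma laplaceB u v : laplace (u - v) = laplace u - laplace v.
Proof.
rewrite /laplace -scalerBr; congr (_ *: _).
rewrite -sumrB; apply: eq_bigr => x _.
by rewrite linearB /= !opprD !opprK addrACA.
Qed.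

Lemma laplaceZ (r : R) v : laplace (r%:C%C *: v) = r%:C%C *: laplace v.
Proof.
rewrite /laplace [RHS]scalerA [X in _ = X *: _]mulrC -[RHS]scalerA; congr (_ *: _).
rewrite scaler_sumr.
by apply: eq_bigr => x _; rewrite linearZ /= scalerBr.
Qed.

(** One step of gradient descent for the energy. *)
Definition half_step v := v - (2^-1)%:C%C *: laplace v.

(** The energy drops by |Lv|^2 - <LLv, Lv> / 4, and L is bounded by 2. *)
Lemma energy_half_step v :
  energy (half_step v) <= energy v - 2^-1 * nrm (laplace v) ^+ 2.
Proof.
have e : energy (half_step v) =
    energy v - nrm (laplace v) ^+ 2 + 4^-1 * energy (laplace v).
  rewrite /energy /half_step laplaceB laplaceZ.
  have := laplace_self (laplace v) v; rewrite -(rdotvv dotH).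
  move: (laplace v) (laplace (laplace v)) => Lv LLv ab.
  by rewrite !(rdotE dot) ab; field.
by rewrite e; have := energy_le (laplace v); lra.
Qed.

Hypothesis gap : forall v, energy v <= 8 * nrm (laplace v) ^+ 2.

(** By the gap the energy of the iterates of half_step decays geometrically, hence
    so do the steps, and the limit has zero energy. *)
Theorem spectral_gap_fixed v (eta : R) : 0 <= eta ->
  (forall x, nrm (rho x v - v) <= eta) ->
  exists2 v', nrm (v' - v) <= 32 * eta & forall x, rho x v' = v'.
Proof.
move=> eta0 veta; pose V j := iter j half_step v; pose r : R := 31 / 32.
have r0 : 0 <= r by rewrite /r; lra.
have r1 : r < 1 by rewrite /r; lra.
(* The energy decreases by a factor 15/16 at each step, and r^2 >= 15/16. *)
have en j : 2 * energy (V j) <= (eta * r ^+ j) ^+ 2.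
  elim: j => [|j IH].
    rewrite expr0 mulr1 energyE -[leRHS]c1; apply: (ler_wpM2l (ltW c0)).
    by apply: ler_sum => x _; rewrite lerXn2r ?nnegrE ?nrm_ge0.
  have := energy_half_step (V j); rewrite -/(V j.+1).
  have := gap (V j) => h1 h2.
  have e : (eta * r ^+ j.+1) ^+ 2 = r ^+ 2 * (eta * r ^+ j) ^+ 2 by rewrite [r ^+ j.+1]exprS; ring.
  have r2 : r ^+ 2 = 961 / 1024 by rewrite /r; field.
  rewrite e r2; have := sqr_ge0 (eta * r ^+ j); have := sqr_ge0 (nrm (laplace (V j))).
  change (iter j.+1 half_step v) with (half_step (V j)) in h2.
  by rewrite /= -/(V j); lra.
have er0 j : 0 <= eta * r ^+ j by rewrite mulr_ge0// exprn_ge0.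
have step j : nrm (V j.+1 - V j) <= eta * r ^+ j.
  have -> : V j.+1 - V j = - ((2^-1)%:C%C *: laplace (V j)).
    by rewrite /V /= /half_step addrC addKr.
  rewrite nrmN nrmZ ger0_norm ?invr_ge0//.
  have := laplace_sqr_le (V j); have := en j; have := nrm_ge0 (laplace (V j)).
  have := er0 j; set a := _ * _; set b := nrm _; set d := energy _.
  move=> a0 b0 h1 h2; rewrite -(@ler_pXn2r _ 2)// ?nnegrE ?mulr_ge0 ?invr_ge0//.
  by rewrite exprMn; nra.
have [v' hv'] := geometric_cvg eta0 r0 r1 step.
have e32 : eta / (1 - r) = 32 * eta by rewrite /r; field.
exists v' => [|x].
  by have := hv' 0; rewrite expr0 mulr1 e32.
apply/eqP; rewrite -subr_eq0; apply/eqP/nrm_eq0/eqP.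
rewrite eq_le nrm_ge0 andbT; apply/ler_addgt0Pr => e e0; rewrite add0r.
pose K := 64 * eta + #|X|%:R * eta.
have K0 : 0 <= K by rewrite addr_ge0// mulr_ge0.
have [j hj] := geometric_small K0 r0 r1 e0; apply: le_trans hj.
have -> : rho x v' - v' = rho x (v' - V j) + ((rho x (V j) - V j) - (v' - V j)).
  by rewrite linearB /= opprB !subrKA.
apply: le_trans (nrmD _ _) _; rewrite rho_nrm.
have h1 := hv' j; rewrite e32 in h1.
have h2 : nrm (rho x (V j) - V j) <= #|X|%:R * (eta * r ^+ j).
  have X1 : 1 <= #|X|%:R :> R by rewrite ler1n.
  rewrite -(@ler_pXn2r _ 2)// ?nnegrE ?mulr_ge0 ?nrm_ge0 ?exprn_ge0//.
  apply: (@le_trans _ _ (\sum_y nrm (rho y (V j) - V j) ^+ 2)).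
    by rewrite (bigD1 x)//= lerDl sumr_ge0// => y _; rewrite sqr_ge0.
  have -> : \sum_y nrm (rho y (V j) - V j) ^+ 2 = #|X|%:R * (2 * energy (V j)).
    by rewrite energyE mulrA divff ?mul1r// pnatr_eq0 -lt0n.
  have -> : (#|X|%:R * (eta * r ^+ j)) ^+ 2 = #|X|%:R * (#|X|%:R * (eta * r ^+ j) ^+ 2).
    by ring.
  apply: ler_wpM2l => //; apply: le_trans (en j) _.
  by rewrite ler_peMl// sqr_ge0.
have := nrmD (rho x (V j) - V j) (- (v' - V j)); rewrite nrmN => h3.
have eK : K * r ^+ j =
    (32 * eta * r ^+ j) + (#|X|%:R * (eta * r ^+ j) + 32 * eta * r ^+ j) by rewrite /K; ring.
by rewrite eK; apply: lerD => //; apply: le_trans h3 _; apply: lerD.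
Qed.

End SpectralGap.

(** * Reduced words and the relators made of three conjugated loops *)

Section ReducedWords.
Variable A : choiceType.
Implicit Types (a b c d : letter A) (w : word A).

Definition composable a b : bool := b != inv_letter a.

(** Words with given end letters are glued by looking at these letters only. *)
Definition span a b w : bool :=
  if w is c :: s then [&& c == a, path composable a s & last a s == b] else false.

Lemma inv_letter_inj : injective (@inv_letter A).
Proof. by move=> [a b] [c d] [-> /negb_inj ->]. Qed.

Lemma inv_letter_neq a : inv_letter a != a.
Proof. by case: a => a b; apply/eqP => -[]; case: b. Qed.

Lemma composable_refl a : composable a a.
Proof. by rewrite /composable eq_sym inv_letter_neq. Qed.

Lemma composable_inv a b : composable (inv_letter a) (inv_letter b) = composable b a.
Proof.
rewrite /composable (inj_eq inv_letter_inj) -[in RHS](inj_eq inv_letter_inj).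
by rewrite inv_letterK eq_sym.
Qed.

Lemma span_cat a b c d w w' : span a b w -> span c d w' -> composable b c ->
  span a d (w ++ w').
Proof.
case: w => // x s /and3P[/eqP -> ps /eqP ls]; case: w' => // y t.
move=> /and3P[/eqP -> pt /eqP lt] bc.
by rewrite /= eqxx cat_path last_cat /= ps ls bc pt lt eqxx.
Qed.

Lemma span_cyclically_reduced a b w :
  span a b w -> composable b a -> cyclically_reduced w.
Proof.
case: w => // x s /and3P[/eqP -> ps /eqP ls] ba.
by rewrite /cyclically_reduced /= rcons_path ls [path _ _ _]ps [X in _ && X]ba.
Qed.

Lemma span_nseq a j : span a a (nseq j.+1 a).
Proof.
rewrite /= eqxx /=; elim: j => [|j] /=; first by rewrite eqxx.
by rewrite composable_refl.
Qed.

Lemma inv_word_cat w w' : inv_word (w ++ w') = inv_word w' ++ inv_word w.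
Proof. by rewrite /inv_word map_cat rev_cat. Qed.

Lemma span_inv a b w : span a b w -> span (inv_letter b) (inv_letter a) (inv_word w).
Proof.
elim: w a => // x [|y s] IH a /and3P[/eqP -> /= ps /eqP ls].
  by rewrite -ls /inv_word /= !eqxx.
case/andP: ps => ay ps; rewrite -cat1s inv_word_cat.
apply: (@span_cat _ (inv_letter y) (inv_letter a)).
- by apply: IH; rewrite /= eqxx ps -ls eqxx.
- by rewrite /= !eqxx.
- by rewrite composable_inv.
Qed.

End ReducedWords.

Section Relators.
Variables (k : nat) (hk : (2 <= k)%N).
Local Notation L := (letter 'I_k).

Definition gen_x : L := (Ordinal (ltnW hk), false).
Definition gen_y : L := (Ordinal hk, false).
Local Notation K := (2 * k - 1)%N.

Definition bracket (g u : word 'I_k) : word 'I_k := g ++ u ++ inv_word g.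

Lemma inv_bracket g u : inv_word (bracket g u) = bracket g (inv_word u).
Proof. by rewrite /bracket !inv_word_cat inv_wordK catA. Qed.

Lemma span_bracket a g u : span a a g -> composable a gen_y ->
  span gen_y (inv_letter gen_y) u -> span a (inv_letter a) (bracket g u).
Proof.
move=> sg ay su; apply: (span_cat sg _ ay).
by apply: (span_cat su (span_inv sg)); rewrite composable_inv.
Qed.

(** These end letters make a loop u, after conjugation by a power of y, by x or by
    x^-1, a reduced word, and the inverse of a loop is a loop. *)
Definition loop m := {u : m.-tuple L | span gen_y (inv_letter gen_y) u}.
HB.instance Definition _ m := Finite.on (loop m).

Definition loop_word m (u : loop m) : word 'I_k := tval (val u).

Lemma loop_span m (u : loop m) : span gen_y (inv_letter gen_y) (loop_word u).
Proof. exact: (valP u). Qed.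

Lemma size_inv_word (w : word 'I_k) : size (inv_word w) = size w.
Proof. by rewrite size_rev size_map. Qed.

Lemma inv_loop_subproof m (u : loop m) :
  span gen_y (inv_letter gen_y) [tuple of rev (map (@inv_letter 'I_k) (val u))].
Proof. by have := span_inv (loop_span u); rewrite inv_letterK. Qed.

Definition inv_loop m (u : loop m) : loop m :=
  Sub [tuple of rev (map (@inv_letter 'I_k) (val u))] (inv_loop_subproof u).

Lemma inv_loopK m : involutive (@inv_loop m).
Proof. by move=> u; do 2!apply: val_inj; exact: inv_wordK. Qed.

(** The three sides begin with the letters y, x, x^-1 and end with the inverses of
    these, so that they can be concatenated cyclically in this order without
    cancellation; the exponent j adjusts the length of the relator to its residue
    modulo 3. *)
Definition conjugator j (i : 'I_3) : word 'I_k :=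
  if val i == 0%N then nseq j gen_y else
  if val i == 1%N then [:: gen_x] else [:: inv_letter gen_x].

Definition side m j (i : 'I_3) (u : loop m) : word 'I_k :=
  bracket (conjugator j i) (loop_word u).

Lemma inv_side m j i (u : loop m) : side j i (inv_loop u) = inv_word (side j i u).
Proof. by rewrite /side inv_bracket. Qed.

Definition pos0 : 'I_3 := ord0.
Definition pos1 : 'I_3 := ordS pos0.
Definition pos2 : 'I_3 := ordS pos1.

Lemma pos_cases (i : 'I_3) : [\/ i = pos0, i = pos1 | i = pos2].
Proof.
case: i => -[|[|[|i]]] // i3; [apply: Or31 | apply: Or32 | apply: Or33]; exact: val_inj.
Qed.

Definition relator m j (t : {ffun 'I_3 -> loop m}) : word 'I_k :=
  side j pos0 (t pos0) ++ side j pos1 (t pos1) ++ side j pos2 (t pos2).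

Lemma relator_reduced m j (t : {ffun 'I_3 -> loop m}) :
  cyclically_reduced (relator j t).
Proof.
have s1 : span gen_y (inv_letter gen_y) (side j pos0 (t pos0)).
  rewrite /side /conjugator /=; case: j => [|j].
    by rewrite /bracket cats0; exact: loop_span.
  exact: span_bracket (span_nseq gen_y j) (composable_refl _) (loop_span (t pos0)).
have s2 : span gen_x (inv_letter gen_x) (side j pos1 (t pos1)).
  exact: span_bracket (span_nseq gen_x 0) _ (loop_span (t pos1)).
have s3 : span (inv_letter gen_x) (inv_letter (inv_letter gen_x)) (side j pos2 (t pos2)).
  exact: span_bracket (span_nseq (inv_letter gen_x) 0) _ (loop_span (t pos2)).
rewrite inv_letterK in s3; apply: (@span_cyclically_reduced _ gen_y gen_x) => //.
have s23 := span_cat s2 s3 (composable_refl _).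
exact: span_cat s1 s23 _.
Qed.

Lemma size_side m j i (u : loop m) :
  size (side j i u) = (m + 2 * (if val i == 0%N then j else 1))%N.
Proof.
rewrite /side /bracket !size_cat size_inv_word size_tuple /conjugator.
by case: (_ == _); rewrite ?size_nseq; [lia|case: (_ == _) => /=; lia].
Qed.

Lemma size_relator m j (t : {ffun 'I_3 -> loop m}) :
  size (relator j t) = (3 * m + 2 * j + 4)%N.
Proof. by rewrite /relator size_cat size_side size_cat !size_side /=; lia. Qed.

Lemma side_inj m j i : injective (@side m j i).
Proof.
move=> u v /eqP; rewrite eqseq_cat// => /andP[_].
rewrite eqseq_cat ?size_tuple// => /andP[/eqP e _].
by do 2!apply: val_inj.
Qed.

Lemma relator_inj m j : injective (@relator m j).
Proof.
move=> t t' /eqP; rewrite /relator eqseq_cat ?size_side// => /andP[/eqP/side_inj e0].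
rewrite eqseq_cat ?size_side// => /andP[/eqP/side_inj e1 /eqP/side_inj e2].
by apply/ffunP => i; case: (pos_cases i) => ->.
Qed.

Fixpoint paths (a : L) r : seq (word 'I_k) :=
  if r is r'.+1 then
    [seq b :: s | b <- [seq b <- enum {: L} | composable a b], s <- paths b r']
  else [:: [::]].

Lemma mem_paths a r s : (s \in paths a r) = (size s == r) && path (@composable _) a s.
Proof.
elim: r a s => [|r IH] a s /=; first by rewrite inE; case: s.
apply/allpairsPdep/idP => [[b [t [hb ht ->]]]|].
  move: hb ht; rewrite mem_filter mem_enum IH => /andP[ab _] /andP[/eqP <- pt].
  by rewrite /= eqxx ab.
case: s => // b s /= /andP[sr /andP[ab ps]].
exists b, s; split=> //; first by rewrite mem_filter ab mem_enum.
by rewrite IH ps andbT.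
Qed.

Lemma uniq_paths a r : uniq (paths a r).
Proof.
elim: r a => //= r IH a; apply: allpairs_uniq_dep.
- by rewrite filter_uniq// enum_uniq.
- by move=> b _; exact: IH.
- by move=> [b s] [c t] _ _ /= [-> ->].
Qed.

Lemma size_paths a r : size (paths a r) = (K ^ r)%N.
Proof.
elim: r a => //= r IH a; rewrite size_allpairs_dep.
rewrite (eq_map (g := fun=> (K ^ r)%N)); last by move=> b; exact: IH.
have -> : forall s : seq L, sumn [seq (K ^ r)%N | _ <- s] = (size s * K ^ r)%N.
  by elim=> //= _ s ->; rewrite mulSn.
rewrite expnS; congr (_ * _)%N.
have -> : size [seq b <- enum {: L} | composable a b] = #|predC1 (inv_letter a)|.
  rewrite enumT cardE /enum_mem !size_filter.
  by apply: eq_count.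
by rewrite cardC1 card_prod card_bool card_ord; lia.
Qed.

(** After y and r free choices, the last but one letter is chosen so as to avoid
    cancellation with both neighbours. *)
Lemma card_loop_ge r : (K ^ r <= #|{: loop r.+3}|)%N.
Proof.
pose c (t : L) := if t == inv_letter gen_x then inv_letter gen_x else gen_x.
pose F (s : word 'I_k) : word 'I_k := gen_y :: s ++ [:: c (last gen_y s); inv_letter gen_y].
rewrite -(size_paths gen_y r) -(size_map F) cardE -(size_map (@loop_word r.+3)).
apply: uniq_leq_size.
  rewrite map_inj_uniq ?uniq_paths// => s t [] /eqP.
  move=> /eqP e; have : size s = size t.
    by have := congr1 size e; rewrite !size_cat /=; lia.
  by move/eqP: e => /[swap] st; rewrite eqseq_cat// => /andP[/eqP].
move=> w /mapP[s]; rewrite mem_paths => /andP[/eqP sr ps] ->.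
have szF : size (F s) == r.+3 by rewrite /= size_cat /= sr addn2.
have spF : span gen_y (inv_letter gen_y) (F s).
  rewrite /= ?eqxx cat_path ps last_cat /= ?eqxx ?andbT /=.
  rewrite /composable /c; case: (eqVneq (last gen_y s) (inv_letter gen_x)) => [->|h]; first by [].
  apply/andP; split; last by [].
  by apply: contraNneq h => ->; rewrite inv_letterK.
apply/mapP; exists (Sub (Tuple szF) spF) => //.
by rewrite mem_enum.
Qed.

Lemma card_cyc_words_le l : (#|cyc_words k l.+1| <= 2 * k * K ^ l)%N.
Proof.
pose P := [seq a :: s | a <- enum {: L}, s <- paths a l].
have -> : (2 * k * K ^ l)%N = size P.
  rewrite size_allpairs_dep.
  rewrite (eq_map (g := fun=> (K ^ l)%N)); last by move=> b; exact: size_paths.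
  have -> : forall s : seq L, sumn [seq (K ^ l)%N | _ <- s] = (size s * K ^ l)%N.
    by elim=> //= _ s ->; rewrite mulSn.
  by rewrite -cardE card_prod card_bool card_ord (mulnC k 2).
rewrite cardE -(size_map (fun w : l.+1.-tuple L => w : word 'I_k)).
apply: uniq_leq_size.
  by rewrite map_inj_uniq ?enum_uniq//; exact: val_inj.
move=> w /mapP[[[|a s] // sz]]; rewrite mem_enum inE => cw ->.
apply/allpairsPdep; exists a, s; split; rewrite ?mem_enum// mem_paths.
move: cw; rewrite /cyclically_reduced /= rcons_path => /andP[ps _].
by rewrite ps andbT; move: sz; rewrite /= eqSS.
Qed.

End Relators.

(** * Uniform subsets against independent samples *)

Section RandomSubset.
Variables (R : realFieldType) (T : finType).
Implicit Types S : {set T}.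

Definition enum_starting_with S : seq T := enum S ++ enum (~: S)%SET.

Lemma mem_enum_starting_with S x : x \in enum_starting_with S.
Proof. by rewrite mem_cat !mem_enum finset.in_setC orbN. Qed.

Lemma uniq_enum_starting_with S : uniq (enum_starting_with S).
Proof.
rewrite cat_uniq !enum_uniq andbT /=; apply/hasPn => x.
by rewrite !mem_enum finset.in_setC.
Qed.

Lemma size_enum_starting_with S : size (enum_starting_with S) = #|T|.
Proof. by rewrite size_cat -!cardE cardsC. Qed.

Lemma mem_take_enum_starting_with S x : (x \in S) = (index x (enum_starting_with S) < #|S|)%N.
Proof.
rewrite /enum_starting_with index_cat mem_enum; case: ifPn => xS.
  by rewrite cardE index_mem mem_enum xS.
by rewrite -cardE ltnNge leq_addr.
Qed.

Lemma perm_moving S S' : #|S| = #|S'| -> exists s : {perm T}, s @: S = S'.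
Proof.
move=> SS'; case: (pickP (mem S)) => [x0 _|S0]; last first.
  have e : S = finset.set0 by apply/setP => x; rewrite finset.in_set0 -(S0 x).
  exists 1%g; rewrite e imset0; apply/esym/eqP.
  by rewrite -cards_eq0 -SS' e cards0.
pose f x := nth x0 (enum_starting_with S') (index x (enum_starting_with S)).
have lt x : (index x (enum_starting_with S) < size (enum_starting_with S'))%N.
  by rewrite size_enum_starting_with -(size_enum_starting_with S) index_mem mem_enum_starting_with.
have fI : injective f.
  move=> x y /eqP; rewrite nth_uniq ?uniq_enum_starting_with// => /eqP.
  by move=> e; have := congr1 (nth x0 (enum_starting_with S)) e; rewrite !nth_index ?mem_enum_starting_with.
exists (perm fI); apply/eqP; rewrite eqEcard (card_imset _ (@perm_inj _ _)) SS' leqnn andbT.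
apply/fintype.subsetP => y /imsetP[x xS ->]; rewrite permE mem_take_enum_starting_with.
by rewrite /f index_uniq ?uniq_enum_starting_with// -SS' -mem_take_enum_starting_with.
Qed.

Lemma superset_of_card S N : (#|S| <= N <= #|T|)%N ->
  exists2 S' : {set T}, S \subset S' & #|S'| = N.
Proof.
move=> /andP[SN NT]; exists [set x in take N (enum_starting_with S)]%SET.
  apply/fintype.subsetP => x xS; rewrite finset.inE -[x \in take _ _]/(_).
  rewrite in_take; last exact: mem_enum_starting_with.
  by apply: leq_trans SN; rewrite -mem_take_enum_starting_with.
rewrite cardsE; apply/eqP; have /card_uniqP -> := take_uniq N (uniq_enum_starting_with S).
rewrite size_take size_enum_starting_with; case: (ltnP N #|T|) => // TN.
by rewrite eqn_leq TN NT.
Qed.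

Lemma natmul_sum (I : finType) (P : {pred I}) (y : R) :
  #|P|%:R * y = \sum_(i in P) y.
Proof. by rewrite sumr_const [LHS]mulr_natl. Qed.

(** Enclose the image of each w in a set S_w of cardinal N.  For a uniform
    permutation s of T, the image of S_w is a uniform set of cardinal N and s o w
    is good only if this image is not bad; moreover s o w is a uniform sample if w
    is one. *)
Lemma random_subset_le_sample N (good : pred {ffun 'I_N -> T}) (bad : pred {set T}) :
  (N <= #|T|)%N ->
  (forall (w : {ffun 'I_N -> T}) S, (forall i, w i \in S) -> good w -> ~~ bad S) ->
  #|[set S : {set T} | (#|S| == N) && bad S]%SET|%:R <=
  #|[set S : {set T} | #|S| == N]%SET|%:R * avg (fun w => (~~ good w)%:R) :> R.
Proof.
move=> NT goodbad; pose NS := [set S : {set T} | #|S| == N]%SET.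
pose b S : R := (bad S)%:R; pose g w : R := (~~ good w)%:R.
pose c S := \sum_(s : {perm T}) b (s @: S).
have cE S S' : S \in NS -> S' \in NS -> c S = c S'.
  rewrite !finset.inE => /eqP e /eqP e'; have [s sS] := perm_moving (etrans e (esym e')).
  rewrite /c -sS [LHS](reindex_inj (mulgI s)) /=; apply: eq_bigr => r _.
  rewrite -imset_comp; congr b; apply: eq_imset => x; exact: permM.
have sumc : \sum_(S in NS) c S = #|{perm T}|%:R * \sum_(S in NS) b S.
  rewrite /c exchange_big /= natmul_sum; apply: eq_bigr => s _.
  have sI : injective (fun S : {set T} => s @: S) by apply: imset_inj; exact: perm_inj.
  rewrite [RHS](reindex_inj sI); apply: eq_bigl => S.
  by rewrite !finset.inE card_imset//; exact: perm_inj.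
have [W0|[S0 S0N]] := set_0Vmem NS.
  have [|S _ SN] := @superset_of_card finset.set0 N; first by rewrite cards0.
  by have : S \in NS; [rewrite finset.inE SN | rewrite W0 finset.in_set0].
have bad_count : #|[set S : {set T} | (#|S| == N) && bad S]%SET|%:R = \sum_(S in NS) b S.
  rewrite -sum1_card natr_sum big_mkcond [RHS]big_mkcond; apply: eq_bigr => S _.
  by rewrite !finset.inE /b; case: (_ == _); case: (bad S).
have c0 : #|NS|%:R * c S0 = #|{perm T}|%:R * \sum_(S in NS) b S.
  rewrite -sumc natmul_sum; apply: eq_bigr => S SN; exact: cE.
have key w : c S0 <= \sum_(s : {perm T}) g [ffun i => s (w i)].
  have [|S wS SN] := @superset_of_card (w @: finset.setT) N.
    by rewrite NT (leq_trans (leq_imset_card _ _))// cardsT card_ord.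
  have SNS : S \in NS by rewrite finset.inE SN.
  rewrite (cE S0 S)// /c; apply: ler_sum => s _; rewrite /b /g ler_nat.
  case: (boolP (good _)) => //= gd; last by case: (bad _).
  have -> // : bad (s @: S) = false.
  apply/negbTE/(goodbad _ _ _ gd) => i; rewrite ffunE imset_f//.
  by apply: (fintype.subsetP wS); rewrite imset_f ?finset.inE.
have sumg : \sum_(w : {ffun 'I_N -> T}) \sum_(s : {perm T}) g [ffun i => s (w i)] =
    #|{perm T}|%:R * \sum_w g w.
  rewrite exchange_big /= natmul_sum; apply: eq_bigr => s _.
  have sI : injective (fun w : {ffun 'I_N -> T} => [ffun i => s (w i)]).
    move=> w w' /ffunP e; apply/ffunP => i; have := e i; rewrite !ffunE.
    exact: perm_inj.
  by rewrite [RHS](reindex_inj sI).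
have P0 : 0 < #|{perm T}|%:R :> R by rewrite ltr0n; apply/card_gt0P; exists 1%g.
rewrite bad_count -(ler_pM2l P0) -c0 mulrCA ler_wpM2l//.
have W0 : 0 < #|{ffun 'I_N -> T}|%:R :> R.
  rewrite ltr0n card_ffun card_ord expn_gt0; case: (posnP N) => [_|Npos].
    by rewrite orbT.
  by rewrite (leq_trans Npos NT).
rewrite /avg mulrA -sumg ler_pdivlMr// mulrC natmul_sum; apply: ler_sum => w _; exact: key.
Qed.

End RandomSubset.

(** * Unitary representations of a presented group *)

Section PresentedRep.
Variables (R : realType) (H : completeNormedModType R[i]).
Variable dot : {dot H for Num.conj}.
Hypothesis dotH : hilbert dot.
Local Notation rdot := (rdot dot).
Variables (A : choiceType) (rels : set (word A)).
Variable rho : presented rels -> {linear H -> H}.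
Hypothesis rhoU : unitary_rep dot rho.
Implicit Types (w : word A) (u v : H).

Definition wrep w : {linear H -> H} := rho (\pi_(presented rels) w).

Lemma wrep_pres_eq w' w : pres_eq rels w' w -> wrep w' = wrep w.
Proof. by move=> uw; congr rho; apply/eqP/pres_piP. Qed.

Lemma wrep_nil v : wrep [::] v = v.
Proof. by have [r1 _ _] := rhoU; exact: r1. Qed.

Lemma wrep_cat w' w v : wrep (w' ++ w) v = wrep w' (wrep w v).
Proof.
have [_ rM _] := rhoU; rewrite /wrep -rM; congr (rho _ v).
exact/esym/pres_mul_pi.
Qed.

Lemma wrep_rel w v : rels w -> wrep w v = v.
Proof.
move=> rw; rewrite -[RHS](wrep_nil v) (@wrep_pres_eq w [::])//.
by have := pres_eq_rel [::] [::] rw; rewrite cats0.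
Qed.

Lemma wrep_Vmul w v : wrep (inv_word w) (wrep w v) = v.
Proof.
by rewrite -wrep_cat (wrep_pres_eq (pres_eq_Vmul _ w)) wrep_nil.
Qed.

Lemma wrep_mulV w v : wrep w (wrep (inv_word w) v) = v.
Proof.
by rewrite -wrep_cat (wrep_pres_eq (pres_eq_mulV _ w)) wrep_nil.
Qed.

Lemma wrep_inj w : injective (wrep w).
Proof. by move=> u v e; rewrite -[u](wrep_Vmul w) e wrep_Vmul. Qed.

Lemma wrep_rdot w u v : rdot (wrep w u) (wrep w v) = rdot u v.
Proof. by have [_ _ rD] := rhoU; rewrite /rdot rD. Qed.

Lemma wrep_adj w u v : rdot (wrep w u) v = rdot u (wrep (inv_word w) v).
Proof. by rewrite -{1}[v](wrep_mulV w) wrep_rdot. Qed.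

Lemma wrep_nrm w v : nrm (wrep w v) = nrm v.
Proof.
apply/eqP; rewrite -(@eqrXn2 _ 2)// ?nrm_ge0//.
by rewrite -!(rdotvv dotH) wrep_rdot.
Qed.

Lemma wrep_close (eta : R) v w :
  (forall a, nrm (wrep [:: a] v - v) <= eta) -> nrm (wrep w v - v) <= (size w)%:R * eta.
Proof.
move=> h; elim: w => [|a w IH]; first by rewrite wrep_nil subrr nrm0 mul0r.
rewrite -cat1s wrep_cat.
rewrite -(subrKA (wrep [:: a] v)) -linearB /=; apply: le_trans (nrmD _ _) _.
by rewrite wrep_nrm -natr1 mulrDl mul1r lerD.
Qed.

End PresentedRep.

Section LoopsFixed.
Variables (R : realType) (H : completeNormedModType R[i]).
Variable dot : {dot H for Num.conj}.
Hypothesis dotH : hilbert dot.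
Variables (k : nat) (hk : (2 <= k)%N).
Variables (rels : set (word 'I_k)) (rho : presented rels -> {linear H -> H}).
Hypothesis rhoU : unitary_rep dot rho.
Local Notation L := (letter 'I_k).
Local Notation r := (wrep rho).
Local Notation X := (gen_x hk).
Local Notation Y := (gen_y hk).
Variables (m : nat) (z : H).
Hypothesis m5 : (5 <= m)%N.
Hypothesis zfix : forall u : loop hk m, r (loop_word u) z = z.

Let z' := r [:: inv_letter Y] z.

(** There are at least four letters. *)
Lemma avoid_two (b c : L) : exists a : L,
  [/\ a != inv_letter Y, a != b & a != c].
Proof.
have d : [/\ X != inv_letter Y, inv_letter X != inv_letter Y & Y != inv_letter Y] by [].
have d2 : [/\ X != inv_letter X, X != Y & inv_letter X != Y] by [].
case: d d2 => d1 d2 d3 [e1 e2 e3].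
case: (eqVneq X b) => [<-|Xb]; case: (eqVneq X c) => [<-|Xc].
- by exists Y; split=> //; rewrite eq_sym.
- case: (eqVneq Y c) => [<-|Yc]; last by exists Y; split=> //; rewrite eq_sym.
  by exists (inv_letter X); split=> //; rewrite eq_sym.
- case: (eqVneq Y b) => [<-|Yb]; last by exists Y; split=> //; rewrite eq_sym.
  by exists (inv_letter X); split=> //; rewrite eq_sym.
- by exists X.
Qed.

Definition tail_ok (s : word 'I_k) : bool :=
  if s is a :: s' then path (@composable _) a s' && (last a s' != Y) else false.

(** A loop is y p s y^-1 with s of length at most 2, and it fixes z, so p s fixes
    z' = y^-1 z.  For two such s of the same length a common prefix p exists,
    namely a power of a single letter. *)
Lemma tails_agree s t : tail_ok s -> tail_ok t -> size s = size t -> (size s <= 2)%N ->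
  r s z' = r t z'.
Proof.
case: s => // a s; case: t => // b t /= /andP[ps ls] /andP[pt lt] [st] s2.
have [c [cY ca cb]] := avoid_two (inv_letter a) (inv_letter b).
pose p := nseq (m - 3 - (size s)) c.
have q0 : (0 < m - 3 - size s)%N by move: m5 s2; rewrite /=; lia.
have fixed d s0 : path (@composable _) d s0 -> last d s0 != Y -> c != inv_letter d ->
    size s0 = size s -> r (p ++ d :: s0) z' = z'.
  move=> ps0 ls0 cd ss0.
  have spn : span Y (inv_letter Y) (Y :: p ++ d :: s0 ++ [:: inv_letter Y]).
    have sp : span c c p.
      by rewrite /p; case: (m - 3 - size s)%N q0 => // q1 _; exact: span_nseq.
    apply: (@span_cat _ Y Y c (inv_letter Y) [:: Y]) => //.
    apply: (span_cat sp (c := d)); last first.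
      by rewrite /composable; apply: contraNneq cd => ->; rewrite inv_letterK.
    by rewrite /= eqxx cat_path ps0 last_cat /= eqxx /composable /= !andbT
           (inj_eq (@inv_letter_inj _)) eq_sym.
  have szw : size (Y :: p ++ d :: s0 ++ [:: inv_letter Y]) == m.
    rewrite /= size_cat /= size_cat /= size_nseq ss0 addn1; apply/eqP.
    by move: (size s) q0 => i i0; clear -i0; lia.
  have := zfix (Sub (Tuple szw) spn); rewrite /loop_word SubK /=.
  rewrite -cat1s (wrep_cat rhoU) -cat_cons catA (wrep_cat rhoU) -/z' => e.
  by apply: (wrep_inj rhoU (w := [:: Y])); rewrite e (wrep_mulV rhoU [:: Y]).
apply: (wrep_inj rhoU (w := p)).
rewrite -(wrep_cat rhoU p (a :: s)) -(wrep_cat rhoU p (b :: t)).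
by rewrite !fixed// ?st// 1?eq_sym.
Qed.

Let zeta := r [:: X] z' + r [:: X; X] z'.

(** By tails_agree, reduced words of length one or two which do not end with y act
    on z' as powers of x do. *)
Lemma letter_step a : r [:: a] (r [:: X] z') = r [:: X; X] z'.
Proof.
case: (eqVneq a (inv_letter X)) => [->|aX].
  rewrite (@tails_agree [:: X] [:: inv_letter Y])//.
  rewrite -(wrep_cat rhoU [:: inv_letter X] [:: inv_letter Y]).
  exact: tails_agree.
rewrite -(wrep_cat rhoU [:: a] [:: X]); apply: tails_agree => //=.
by rewrite /composable andbT /= andbT; apply: contraNneq aX => ->; rewrite inv_letterK.
Qed.

Lemma letter_step_back a : r [:: a] (r [:: X; X] z') = r [:: X] z'.
Proof.
rewrite -(letter_step (inv_letter a)).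
exact: (wrep_mulV rhoU [:: a]).
Qed.

(** By the two preceding lemmas every letter exchanges the two summands of
    zeta. *)
Lemma sum_fixed g : rho g zeta = zeta.
Proof.
elim/pres_ind: g => w; rewrite -/(wrep rho w); elim: w => [|a w IH].
  exact: (wrep_nil rhoU).
rewrite -cat1s (wrep_cat rhoU) IH /zeta linearD /= letter_step letter_step_back.
exact: addrC.
Qed.

End LoopsFixed.

(** * The link graph of a relator *)

Section LinkGraph.
Variables (R : realType) (k : nat) (hk : (2 <= k)%N) (m j : nat).
Local Notation U := (loop hk m).
(** The vertex (i, u) stands for the i-th side built on the loop u. *)
Definition vertex : Type := ('I_3 * U)%type.
HB.instance Definition _ := Finite.on vertex.
Local Notation V := vertex.
Local Notation n := #|{: loop hk m}|.
Local Notation nv := #|{: vertex}|.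
Let l := (3 * m + 2 * j + 4)%N.
Definition reduced_tuple : Type := {w : l.-tuple (letter 'I_k) | w \in cyc_words k l}.
HB.instance Definition _ := Finite.on reduced_tuple.
Local Notation Om := reduced_tuple.
Local Notation loops := {ffun 'I_3 -> U}.
Implicit Types (t : {ffun 'I_3 -> U}) (p q : V) (o : Om).

Definition vert_inv p : V := (p.1, inv_loop p.2).

Lemma vert_invK : involutive vert_inv.
Proof. by case=> i u; rewrite /vert_inv /= inv_loopK. Qed.

(** The edge joins the side at position i + 1 to the inverse of the side at
    position i, both of them sides of the relator t. *)
Definition half_link t p q : R :=
  ((p.1 == ordS q.1) && (p.2 == t p.1) && (vert_inv q == (q.1, t q.1)))%:R.

Definition link t p q : R := half_link t p q + half_link t q p.

(** The sum has at most one nonzero term, and none when the word o is not of the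
    form relator j t. *)
Definition adjacency o p q : R :=
  \sum_(t : loops) (relator j t == val (val o) :> seq _)%:R * link t p q.

Lemma link_ge0 t p q : 0 <= link t p q.
Proof. by rewrite addr_ge0. Qed.

Lemma adjacency_ge0 o p q : 0 <= adjacency o p q.
Proof. by apply: sumr_ge0 => t _; rewrite mulr_ge0 ?link_ge0. Qed.

Lemma adjacency_sym o p q : adjacency o p q = adjacency o q p.
Proof. by apply: eq_bigr => t _; rewrite /link addrC. Qed.

Definition link_degree t p : R := (p == (p.1, t p.1))%:R + (vert_inv p == (p.1, t p.1))%:R.

Lemma sum_delta (T : finType) (F : T -> R) (P : pred T) x : (forall y, P y = (y == x)) ->
  \sum_y (P y)%:R * F y = F x.
Proof.
move=> Px; rewrite (bigD1 x)//= Px eqxx mul1r big1 ?addr0// => y /negbTE yx.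
by rewrite Px yx mul0r.
Qed.

Lemma half_link_row t p (F : V -> R) :
  \sum_q half_link t p q * F q =
  (p == (p.1, t p.1))%:R * F (vert_inv (ord_pred p.1, t (ord_pred p.1))).
Proof.
case: (boolP (p.2 == t p.1)) => h; last first.
  rewrite big1 => [|q _]; last by rewrite /half_link (negbTE h) andbF mul0r.
  by case: p h => i u /= h; rewrite xpair_eqE (negbTE h) andbF mul0r.
have -> : (p == (p.1, t p.1)) = true by case: p h => i u /= h; rewrite xpair_eqE eqxx.
rewrite mul1r; apply: sum_delta => q; rewrite h andbT.
apply/andP/eqP => [[/eqP -> /eqP e]|->].
  by rewrite ordSK -e vert_invK.
by rewrite /= ord_predK eqxx vert_invK eqxx.
Qed.

Lemma half_link_col t p (F : V -> R) :
  \sum_q half_link t q p * F q =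
  (vert_inv p == (p.1, t p.1))%:R * F (ordS p.1, t (ordS p.1)).
Proof.
case: (boolP (vert_inv p == _)) => h; last first.
  by rewrite big1 ?mul0r// => q _; rewrite /half_link (negbTE h) andbF mul0r.
rewrite mul1r; apply: sum_delta => q; rewrite h andbT.
case: q => i u /=; rewrite xpair_eqE.
by case: eqP => //= ->.
Qed.

Lemma sum_link t p : \sum_q link t p q = link_degree t p.
Proof.
rewrite /link big_split /=; congr (_ + _).
  have := half_link_row t p (fun=> 1); rewrite mulr1 => <-.
  by apply: eq_bigr => q _; rewrite mulr1.
have := half_link_col t p (fun=> 1); rewrite mulr1 => <-.
by apply: eq_bigr => q _; rewrite mulr1.
Qed.

Lemma adjacency_deg o p :
  \sum_q adjacency o p q = \sum_(t : loops) (relator j t == val (val o) :> seq _)%:R * link_degree t p.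
Proof.
rewrite exchange_big /=; apply: eq_bigr => t _.
by rewrite -mulr_sumr sum_link.
Qed.

Lemma adjacency_deg_le2 o p : \sum_q adjacency o p q <= 2.
Proof.
have ld t : link_degree t p <= 2 by rewrite /link_degree; do 2!case: (_ == _) => /=; lra.
rewrite adjacency_deg.
case: (pickP (fun t => relator j t == val (val o) :> seq _)) => [t0 /eqP t0E|h].
  rewrite (@sum_delta _ _ _ t0)// => t; apply/eqP/eqP => [e|-> //].
  by apply: (@relator_inj _ hk m j); rewrite e t0E.
by rewrite big1// => t _; rewrite h mul0r.
Qed.

Lemma relator_tuple_subproof t : size (relator j t) == l.
Proof. by rewrite size_relator. Qed.

Lemma relator_tuple_reduced t : Tuple (relator_tuple_subproof t) \in cyc_words k l.
Proof. by rewrite finset.inE; exact: relator_reduced. Qed.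

Definition relator_tuple t : Om :=
  exist (fun w => w \in cyc_words k l) _ (relator_tuple_reduced t).

Lemma relator_tupleE t : val (val (relator_tuple t)) = relator j t.
Proof. by []. Qed.

Lemma sum_relator t (y : R) :
  \sum_(o : Om) (relator j t == val (val o) :> seq _)%:R * y = y.
Proof.
apply: (@sum_delta _ (fun=> y) _ (relator_tuple t)) => o.
rewrite -relator_tupleE; apply/eqP/eqP => [e|-> //]; exact/esym/val_inj/val_inj.
Qed.

Lemma Om_gt0 : (0 < n)%N -> (0 < #|{: Om}|)%N.
Proof.
case/card_gt0P => u _; apply/card_gt0P.
by exists (relator_tuple [ffun=> u]).
Qed.

Lemma card_loops_le : (n ^ 3 <= #|{: Om}|)%N.
Proof.
have -> : (n ^ 3 = #|{ffun 'I_3 -> U}|)%N by rewrite card_ffun card_ord.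
apply: (@leq_card _ _ relator_tuple) => t t' e; apply: (@relator_inj _ hk m j).
by rewrite -!relator_tupleE e.
Qed.

Lemma sum_prod_loops (F : 'I_3 -> U -> R) :
  \sum_(t : loops) \prod_i F i (t i) = \prod_i \sum_u F i u.
Proof. by rewrite bigA_distr_bigA. Qed.

Lemma sum_eq_loop (u : U) : \sum_(v : U) ((v == u)%:R : R) = 1.
Proof.
have := @sum_delta U (fun=> 1) (fun v => v == u) u; under eq_bigr do rewrite mulr1.
exact.
Qed.

Lemma sum_one_loop : \sum_(v : U) (1 : R) = n%:R.
Proof. by rewrite sumr_const. Qed.

Lemma card_coord (i : 'I_3) (u : U) : \sum_(t : loops) ((t i == u)%:R : R) = n%:R ^+ 2.
Proof.
pose F i' (v : U) : R := if i' == i then (v == u)%:R else 1.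
have -> : \sum_(t : loops) ((t i == u)%:R : R) = \sum_(t : loops) \prod_i' F i' (t i').
  apply: eq_bigr => t _; rewrite (bigD1 i)//= /F eqxx big1 ?mulr1// => i'.
  by move=> /negbTE ->.
rewrite sum_prod_loops (bigD1 i)//= {1}/F eqxx sum_eq_loop mul1r.
rewrite (eq_bigr (fun=> n%:R)) => [|i' /negbTE h]; last by rewrite /F h sum_one_loop.
by rewrite prodr_const cardC1 card_ord.
Qed.

Lemma card_coord2 (i i' : 'I_3) (u u' : U) : i != i' ->
  \sum_(t : loops) (((t i == u) && (t i' == u'))%:R : R) = n%:R.
Proof.
move=> ii'.
pose F a (v : U) : R := if a == i then (v == u)%:R else if a == i' then (v == u')%:R else 1.
have i'i : (i' == i) = false by rewrite eq_sym; exact: negbTE.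
have -> : \sum_(t : loops) (((t i == u) && (t i' == u'))%:R : R) = \sum_(t : loops) \prod_a F a (t a).
  apply: eq_bigr => t _; rewrite (bigD1 i)//= (bigD1 i')/= ?i'i// /F eqxx i'i eqxx.
  rewrite big1 => [|a /andP[/negbTE -> /negbTE ->]//].
  by rewrite mulr1 -natrM mulnb.
rewrite sum_prod_loops (bigD1 i)//= (bigD1 i')/= ?i'i// {1 2}/F eqxx i'i eqxx !sum_eq_loop !mul1r.
rewrite (eq_bigr (fun=> n%:R)) => [|a /andP[/negbTE h /negbTE h']]; last first.
  by rewrite /F h h' sum_one_loop.
rewrite prodr_const; set c := #|_|.
have : (2 + c = 3)%N.
  rewrite -[RHS](card_ord 3) -(cardC (pred2 i i')) card2 ii'; congr (_ + _)%N.
  by apply: eq_card => a; rewrite !inE negb_or.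
by case: c => [|[|c]] // _; rewrite expr1.
Qed.

Local Notation card_Om := #|{: reduced_tuple}|.

Lemma avg_adjacency_deg p :
  avg (fun o => \sum_q adjacency o p q) = 2 * n%:R ^+ 2 / card_Om%:R.
Proof.
rewrite /avg; congr (_ / _); under eq_bigr do rewrite adjacency_deg.
rewrite exchange_big /=; under eq_bigr do rewrite sum_relator.
rewrite /link_degree big_split /=.
have e (q : V) : \sum_(t : loops) ((q == (q.1, t q.1))%:R : R) = n%:R ^+ 2.
  rewrite -(card_coord q.1 q.2); apply: eq_bigr => t _.
  by case: q => i u /=; rewrite xpair_eqE eqxx eq_sym.
by rewrite e (e (vert_inv p)) mulr2n mulrDl mul1r.
Qed.

Lemma ordS_neq (i : 'I_3) : ordS i != i.
Proof. by case: (pos_cases i) => ->. Qed.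

Lemma sum_half_link p q :
  \sum_(t : loops) half_link t p q = (p.1 == ordS q.1)%:R * n%:R.
Proof.
case: (eqVneq p.1 (ordS q.1)) => h; last first.
  by rewrite mul0r big1// => t _; rewrite /half_link (negbTE h).
have pq : p.1 != q.1 by rewrite h ordS_neq.
rewrite mul1r -(card_coord2 p.2 (inv_loop q.2) pq); apply: eq_bigr => t _.
rewrite /half_link h eqxx /= /vert_inv xpair_eqE eqxx /=.
by rewrite [p.2 == _]eq_sym [inv_loop _ == _]eq_sym.
Qed.

Lemma avg_adjacency p q :
  avg (fun o => adjacency o p q) = n%:R / card_Om%:R * (p.1 != q.1)%:R.
Proof.
rewrite /avg mulrAC; congr (_ / _); rewrite exchange_big /=.
under eq_bigr do rewrite sum_relator.
rewrite /link big_split /= !sum_half_link -mulrDl mulrC; congr (_ * _).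
case: p q => [i u] [i' u'] /=.
by case: (pos_cases i) => ->; case: (pos_cases i') => ->; rewrite ?eqxx /= ?addr0 ?add0r.
Qed.

End LinkGraph.

(** * A criterion for property (T) *)

Section Criterion.
Variables (R : realType) (k : nat) (hk : (2 <= k)%N) (m j N : nat).
Local Notation U := (loop hk m).
Local Notation V := (vertex hk m).
Local Notation n := #|{: loop hk m}|.
Local Notation nv := #|{: vertex hk m}|.
Local Notation Om := (reduced_tuple k m j).
Local Notation loops := {ffun 'I_3 -> U}.
Hypothesis n0 : (0 < n)%N.

Definition adjacency_mx (o : Om) : 'M[R]_nv :=
  \matrix_(x, y) adjacency R o (enum_val x) (enum_val y).

Definition mean_degree : R := 2 * n%:R ^+ 2 / #|{: Om}|%:R.

Lemma sum_enum_val (F : V -> R) : \sum_(x : 'I_nv) F (enum_val x) = \sum_p F p.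
Proof. by rewrite -(big_enum_val (A := {: V}) F). Qed.

Lemma sum_vertex (M : nmodType) (F : V -> M) : \sum_p F p = \sum_i \sum_u F (i, u).
Proof. by rewrite pair_bigA /=; apply: eq_bigr => -[]. Qed.

Lemma nvE : nv = (3 * n)%N.
Proof. by rewrite card_prod card_ord. Qed.

Lemma nv_gt0 : (0 < nv)%N.
Proof. by rewrite nvE muln_gt0. Qed.

Lemma adjacency_mx_sym o : (adjacency_mx o)^T = adjacency_mx o.
Proof. by apply/matrixP => x y; rewrite !mxE adjacency_sym. Qed.

Lemma adjacency_mx_ge0 o x y : 0 <= adjacency_mx o x y.
Proof. by rewrite mxE adjacency_ge0. Qed.

Lemma adjacency_mx_row o x :
  \sum_y adjacency_mx o x y = \sum_q adjacency R o (enum_val x) q.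
Proof. by rewrite -sum_enum_val; apply: eq_bigr => y _; rewrite mxE. Qed.

Lemma adjacency_mx_row_le2 o x : \sum_y adjacency_mx o x y <= 2.
Proof. by rewrite adjacency_mx_row adjacency_deg_le2. Qed.

Lemma avg_adjacency_mx_row x :
  avg (fun o => \sum_y adjacency_mx o x y) = mean_degree.
Proof. by under eq_avg do rewrite adjacency_mx_row; exact: avg_adjacency_deg. Qed.

Definition good_relators (q : nat) (ws : {ffun 'I_N -> Om}) : bool :=
  good_sample adjacency_mx mean_degree q ws.

Lemma good_relators_prob q (delta := N%:R * mean_degree) :
  1 <= delta -> 4 * (2 ^ q)%:R <= delta ->
  avg (fun ws => (~~ good_relators q ws)%:R : R) <=
  nv%:R * expR (- delta / 8) +
  nv%:R ^+ 2 * (moment_const R * (2 ^ q)%:R / delta) ^+ (2 ^ q).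
Proof.
move=> d1 dq; apply: bad_sample_prob => //.
- exact: Om_gt0.
- exact: nv_gt0.
- exact: adjacency_mx_sym.
- exact: adjacency_mx_ge0.
- exact: adjacency_mx_row_le2.
- exact: avg_adjacency_mx_row.
Qed.

Section Representation.
Variables (H : completeNormedModType R[i]) (dot : {dot H for Num.conj}).
Hypothesis dotH : hilbert dot.
Local Notation rdot := (rdot dot).
Variables (rels : set (word 'I_k)) (rho : presented rels -> {linear H -> H}).
Hypothesis rhoU : unitary_rep dot rho.
Variables (ws : {ffun 'I_N -> Om}).
Hypothesis ws_rels : forall i, rels (val (val (ws i))).
Local Notation r := (wrep rho).

Definition act (p : V) : {linear H -> H} := r (side j p.1 p.2).

Lemma act_inv p v : act (vert_inv p) v = r (inv_word (side j p.1 p.2)) v.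
Proof. by rewrite /act /= inv_side. Qed.

Lemma act_adj p u v : rdot (act p u) v = rdot u (act (vert_inv p) v).
Proof. by rewrite act_inv; exact: wrep_adj. Qed.

Lemma act_nrm p v : nrm (act p v) = nrm v.
Proof. exact: (wrep_nrm dotH rhoU). Qed.

Variable v : H.
Let f p : H := act p v - v.

Lemma nrm_displacement_inv p : nrm (f (vert_inv p)) = nrm (f p).
Proof.
rewrite /f -(act_nrm p) linearB /= act_inv (wrep_mulV rhoU).
exact: nrmB.
Qed.

(** The three cyclic rotations of a relator act trivially as well. *)
Lemma relator_cyclic (t : loops) i u : rels (relator j t) ->
  act (ord_pred i, t (ord_pred i)) (act (i, t i) (act (ordS i, t (ordS i)) u)) = u.
Proof.
move=> rt.
have base x : act (pos0, t pos0) (act (pos1, t pos1) (act (pos2, t pos2) x)) = x.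
  by rewrite /act /= -!(wrep_cat rhoU) -catA (wrep_rel rhoU).
have p0 : ord_pred pos0 = pos2 by exact: val_inj.
have p1 : ord_pred pos1 = pos0 by rewrite /pos1 ordSK.
have p2 : ord_pred pos2 = pos1 by rewrite /pos2 ordSK.
have s2 : ordS pos2 = pos0 by exact: val_inj.
have inj p : injective (act p) by exact: (wrep_inj rhoU).
case: (pos_cases i) => ->.
- by rewrite p0; apply: (inj (pos1, t pos1)); apply: (inj (pos0, t pos0)); rewrite base.
- by rewrite p1 base.
- by rewrite p2 s2; apply: (inj (pos0, t pos0)); rewrite base.
Qed.

(** The edges of the link are the corners of the triangle with sides w_0, w_1, w_2
    in the Cayley complex, so that the difference of the displacements at the ends
    of an edge is the displacement of the opposite side up to an isometry. *)
Lemma triangle_side (t : loops) i : rels (relator j t) ->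
  nrm (f (i, t i) - f (vert_inv (ord_pred i, t (ord_pred i)))) =
  nrm (f (ordS i, t (ordS i))).
Proof.
move=> rt; set p := (i, t i); set p' := (ord_pred i, t (ord_pred i)).
set p'' := (ordS i, t (ordS i)).
have -> : f p - f (vert_inv p') = act p v - act (vert_inv p') v.
  by rewrite /f opprB addrA subrK.
rewrite -(act_nrm p') linearB /= [act (vert_inv p') v]act_inv.
rewrite {2}/act (wrep_mulV rhoU) -(nrm_displacement_inv p'') /f.
congr (nrm (_ - _)); rewrite -[RHS](relator_cyclic i _ rt) -/p -/p' -/p''.
by rewrite act_inv /act (wrep_mulV rhoU).
Qed.

Lemma sum_graph (t : loops) (F : V -> R) :
  \sum_p (p == (p.1, t p.1))%:R * F p = \sum_i F (i, t i).
Proof.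
rewrite sum_vertex /=; apply: eq_bigr => i _.
apply: (@sum_delta _ _ (fun u => F (i, u)) _ (t i)) => u.
by rewrite xpair_eqE eqxx.
Qed.

Lemma polarize a b : 2 * rdot a b = nrm a ^+ 2 + nrm b ^+ 2 - nrm (a - b) ^+ 2.
Proof. by rewrite (nrmB_sqr dotH); ring. Qed.

(** Polarization on each edge: the square norm of each of the three displacements
    occurs twice with sign plus, at the ends of an edge, and once with sign minus,
    opposite to it. *)
Lemma link_form (t : loops) : rels (relator j t) ->
  \sum_p \sum_q link R t p q * rdot (f p) (f q) = \sum_i nrm (f (i, t i)) ^+ 2.
Proof.
move=> rt.
have -> : \sum_p \sum_q link R t p q * rdot (f p) (f q) =
    \sum_p \sum_q half_link R t p q * (2 * rdot (f p) (f q)).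
  under eq_bigr do under eq_bigr do rewrite /link mulrDl.
  under eq_bigr do rewrite big_split /=.
  rewrite big_split /= [X in _ + X]exchange_big /= -big_split /=.
  apply: eq_bigr => p _; rewrite -big_split /=; apply: eq_bigr => q _.
  by rewrite (rdotC dot (f q)); ring.
under eq_bigr do rewrite half_link_row.
rewrite (sum_graph t (fun p => 2 * rdot (f p) (f (vert_inv (ord_pred p.1, t (ord_pred p.1)))))) /=.
under eq_bigr do rewrite polarize triangle_side// nrm_displacement_inv.
rewrite sumrB big_split /=.
pose F i := nrm (f (i, t i)) ^+ 2.
have e1 : \sum_i F (ord_pred i) = \sum_i F i by rewrite [RHS](reindex_inj (@ord_pred_inj 3)).
have e2 : \sum_i F (ordS i) = \sum_i F i by rewrite [RHS](reindex_inj (@ordS_inj 3)).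
by rewrite -/F e1 e2 addrK.
Qed.

Lemma link_deg_form (t : loops) :
  \sum_p link_degree R t p * nrm (f p) ^+ 2 = 2 * \sum_i nrm (f (i, t i)) ^+ 2.
Proof.
under eq_bigr do rewrite /link_degree mulrDl.
rewrite big_split /= sum_graph.
rewrite [X in _ + X](reindex_inj (inv_inj (@vert_invK _ hk m))) /=.
under [X in _ + X]eq_bigr do rewrite vert_invK nrm_displacement_inv.
by rewrite sum_graph mulr2n mulrDl mul1r.
Qed.

Lemma adjacency_form (o : Om) : rels (val (val o)) ->
  2 * (\sum_p \sum_q adjacency R o p q * rdot (f p) (f q)) =
  \sum_p (\sum_q adjacency R o p q) * nrm (f p) ^+ 2.
Proof.
move=> ro; under [RHS]eq_bigr do rewrite adjacency_deg mulr_suml.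
rewrite [RHS]exchange_big /=.
under eq_bigr do under eq_bigr do rewrite /adjacency mulr_suml.
under eq_bigr do rewrite exchange_big /=.
rewrite exchange_big mulr_sumr /=; apply: eq_bigr => t _.
case: eqP => [e|_]; last first.
  by rewrite !big1 ?mulr0// => p _; rewrite ?big1// => *; rewrite !mul0r.
under eq_bigr do under eq_bigr do rewrite mul1r.
under [RHS]eq_bigr do rewrite mul1r.
by rewrite link_form ?e// link_deg_form.
Qed.

Definition gram : 'M[R]_nv := \matrix_(x, y) rdot (f (enum_val x)) (f (enum_val y)).

Lemma gram_sym : gram^T = gram.
Proof. by apply/matrixP => x y; rewrite !mxE rdotC. Qed.

Lemma gram_psd : psd gram.
Proof.
move=> c; pose s := \sum_x (c 0 x)%:C%C *: f (enum_val x).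
have -> : (c *m gram *m c^T) 0 0 = rdot s s; last by rewrite (rdotvv dotH) sqr_ge0.
rewrite /s rdot_sumr mxE; apply: eq_bigr => y _; rewrite !mxE rdotZr mulrC rdot_suml.
by congr (_ * _); apply: eq_bigr => x _; rewrite rdotZl mxE.
Qed.

Lemma trace_mul_gram (F : V -> V -> R) (M : 'M[R]_nv) :
  (forall x y, M x y = F (enum_val x) (enum_val y)) ->
  \tr (M *m gram) = \sum_p \sum_q F p q * rdot (f p) (f q).
Proof.
move=> MF; rewrite -(sum_enum_val (fun p => \sum_q F p q * rdot (f p) (f q))).
apply: eq_bigr => x _; rewrite mxE -sum_enum_val; apply: eq_bigr => y _.
by rewrite MF mxE rdotC.
Qed.

Lemma trace_gram : \tr gram = \sum_p nrm (f p) ^+ 2.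
Proof.
by rewrite -sum_enum_val; apply: eq_bigr => x _; rewrite mxE (rdotvv dotH).
Qed.

Lemma sample_form :
  2 * \tr (sample_sum adjacency_mx ws *m gram) =
  \sum_x (\sum_y sample_sum adjacency_mx ws x y) * nrm (f (enum_val x)) ^+ 2.
Proof.
rewrite /sample_sum mulmx_suml linear_sum mulr_sumr /=.
under [RHS]eq_bigr do under eq_bigr do rewrite summxE.
under [RHS]eq_bigr do rewrite exchange_big mulr_suml /=.
rewrite [RHS]exchange_big /=; apply: eq_bigr => i _.
rewrite (trace_mul_gram (F := adjacency R (ws i))) => [|x y]; last by rewrite mxE.
rewrite adjacency_form; last exact: ws_rels.
by rewrite -sum_enum_val; apply: eq_bigr => x _; rewrite adjacency_mx_row.
Qed.

(** If s_i is the sum of f over the i-th family, the complete tripartite graph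
    gives |s|^2 - (|s_0|^2 + |s_1|^2 + |s_2|^2), where s is the sum of the s_i, and
    |s|^2 <= 3 (|s_0|^2 + |s_1|^2 + |s_2|^2). *)
Lemma mean_form :
  \tr (mean_mx adjacency_mx *m gram) <=
  n%:R / #|{: Om}|%:R * (2 / 3) * nrm (\sum_p f p) ^+ 2.
Proof.
rewrite (trace_mul_gram (F := fun p q => n%:R / #|{: Om}|%:R * (p.1 != q.1)%:R)); last first.
  move=> x y; rewrite mxE -avg_adjacency.
  by apply: eq_avg => o; rewrite mxE.
pose s i : H := \sum_u f (i, u).
have sE : \sum_p f p = \sum_i s i by exact: sum_vertex.
have -> : \sum_p \sum_q n%:R / #|{: Om}|%:R * (p.1 != q.1)%:R * rdot (f p) (f q) =
  n%:R / #|{: Om}|%:R * \sum_i \sum_i' (i != i')%:R * rdot (s i) (s i').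
  rewrite sum_vertex /= mulr_sumr; apply: eq_bigr => i _; rewrite mulr_sumr.
  under eq_bigr do rewrite sum_vertex /=.
  rewrite exchange_big /=; apply: eq_bigr => i' _.
  rewrite /s rdot_suml mulrA mulr_sumr; apply: eq_bigr => u _.
  by rewrite rdot_sumr mulr_sumr.
rewrite -[leRHS]mulrA ler_wpM2l ?divr_ge0// sE.
rewrite !big_ord_recl !big_ord0 /= !addr0 -!(rdotvv dotH) !(rdotE dot).
set a := s _; set b := s _; set c := s _.
have := sqr_ge0 (nrm (a - b)); have := sqr_ge0 (nrm (b - c)); have := sqr_ge0 (nrm (a - c)).
rewrite -!(rdotvv dotH) !(rdotE dot) (rdotC dot b a) (rdotC dot c a) (rdotC dot c b).
move=> h1 h2 h3; lra.
Qed.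

(** Comparing link and mean: the degrees bound twice the form of the sample from
    below by delta / 4 tr gram, and goodness bounds this form from above by the form
    of the mean plus delta / 16 tr gram.  What remains of tr gram is proportional
    to the energy, and the bound of mean_form to the square norm of the Laplacian. *)
Lemma good_gap q : good_relators q ws -> 0 < N%:R * mean_degree ->
  energy dot act v <= 8 * nrm (laplace act v) ^+ 2.
Proof.
move=> good; set delta := N%:R * mean_degree => d0.
have := good_sample_form (Om_gt0 j n0) nv_gt0 adjacency_mx_sym adjacency_mx_ge0
  avg_adjacency_mx_row good gram_sym gram_psd.
rewrite -/delta ler_norml => /andP[_ upper].
have n1 : 0 < n%:R :> R by rewrite ltr0n.
have nvR : nv%:R = 3 * n%:R :> R by rewrite nvE natrM.
have nvn0 : 3 * n%:R != 0 :> R by rewrite mulf_neq0// gt_eqF.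
have trE : \tr gram = 6 * n%:R * energy dot act v.
  rewrite trace_gram; have := energyE dotH act_nrm v; rewrite nvR => e.
  have -> : 6 * n%:R * energy dot act v = 3 * n%:R * (2 * energy dot act v) by ring.
  by rewrite e mulrA divff// mul1r.
have sE : nrm (\sum_p f p) ^+ 2 = 9 * n%:R ^+ 2 * nrm (laplace act v) ^+ 2.
  rewrite /laplace nrmZ nvR exprMn.
  have -> : \sum_p (v - act p v) = - \sum_p f p.
    by rewrite -sumrN; apply: eq_bigr => p _; rewrite opprB.
  rewrite nrmN real_normK ?num_real//; field.
  by rewrite gt_eqF.
have lower : delta / 4 * \tr gram <= 2 * \tr (sample_sum adjacency_mx ws *m gram).
  rewrite sample_form trace_gram -sum_enum_val mulr_sumr; apply: ler_sum => x _.
  rewrite ler_wpM2r ?sqr_ge0//.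
  by move: good => /andP[/forallP].
have mean := mean_form; rewrite sE in mean.
have Nmean : N%:R * (n%:R / #|{: Om}|%:R * (2 / 3) * (9 * n%:R ^+ 2 * nrm (laplace act v) ^+ 2))
   = 3 * delta * n%:R * nrm (laplace act v) ^+ 2.
  rewrite /delta /mean_degree; field.
  by rewrite pnatr_eq0 -lt0n; exact: Om_gt0.
have mean' := ler_wpM2l (ler0n _ N) mean; rewrite Nmean in mean'.
rewrite trE in upper lower.
set E := energy dot act v in upper lower *; set L := _ ^+ 2 in mean' *.
have : delta * n%:R * E <= delta * n%:R * (8 * L) by lra.
by rewrite ler_pM2l// mulr_gt0.
Qed.

End Representation.

(** The Kazhdan pair consists of the letters and of a constant of order 1 / l: a
    side is a word of length at most l, so it moves an almost invariant vector by
    at most l times what letters do. *)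
Theorem property_T_of_good_relators (rels : set (word 'I_k)) (ws : {ffun 'I_N -> Om}) q :
  (5 <= m)%N -> 0 < N%:R * mean_degree -> good_relators q ws ->
  (forall i, rels (val (val (ws i)))) -> property_T R (presented rels).
Proof.
move=> m5 d0 good ws_rels; pose l := (3 * m + 2 * j + 4)%N.
exists [seq \pi_(presented rels) [:: a] | a <- enum {: letter 'I_k}].
exists ((64 * l + 8)%:R^-1 : R); split; first by rewrite invr_gt0 ltr0n addn_gt0 orbT.
move=> H dot rho dotH rhoU [v v0 vQ].
set eps : R := (64 * l + 8)%:R^-1 in vQ.
pose eta := eps * nrm v.
have eps0 : 0 <= eps by rewrite invr_ge0.
have eta0 : 0 <= eta by rewrite mulr_ge0 ?nrm_ge0.
have letter_close a : nrm (wrep rho [:: a] v - v) <= eta.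
  have := vQ (\pi_(presented rels) [:: a]).
  rewrite map_f ?mem_enum// => /(_ isT).
  by rewrite !nrmE -rmorphM /= ltcR => /ltW.
have close w : nrm (wrep rho w v - v) <= (size w)%:R * eta.
  exact: (wrep_close dotH rhoU).
have leta0 : 0 <= l%:R * eta by rewrite mulr_ge0.
have act_close p : nrm (act (rels := rels) rho p v - v) <= l%:R * eta.
  apply: le_trans (close _) _; rewrite ler_wpM2r// ler_nat size_side /l.
  by case: ifP => _; lia.
have [v' v'v v'fix] := spectral_gap_fixed dotH nv_gt0 (@vert_invK _ hk m)
    (act_adj rhoU) (act_nrm dotH rhoU)
    (fun u => good_gap dotH rhoU ws_rels u good d0) leta0 act_close.
pose z := wrep rho [:: inv_letter (gen_x hk)] v'.
have zfix (u : loop hk m) : wrep rho (loop_word u) z = z.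
  have := v'fix (pos1, u); rewrite /act /side /= /bracket /= -cat1s catA !(wrep_cat rhoU) => e.
  by rewrite /z -[in RHS]e (wrep_Vmul rhoU [:: gen_x hk]).
have inv := sum_fixed rhoU m5 zfix.
set zeta := (_ + _) in inv.
exists zeta; last exact: inv.
have close' w : nrm (wrep rho w v' - v) <= 32 * (l%:R * eta) + (size w)%:R * eta.
  rewrite -(subrKA (wrep rho w v)) -linearB /=; apply: le_trans (nrmD _ _) _.
  by rewrite (wrep_nrm dotH rhoU) lerD.
have zetaE : zeta = wrep rho [:: gen_x hk; inv_letter (gen_y hk); inv_letter (gen_x hk)] v' +
   wrep rho [:: gen_x hk; gen_x hk; inv_letter (gen_y hk); inv_letter (gen_x hk)] v'.
  by rewrite /zeta /z -!(wrep_cat rhoU).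
apply/eqP => zeta0.
(* The two translates of v' in zeta are by words of 3 and 4 letters. *)
have small : nrm (zeta - (v + v)) <= (64 * l + 7)%:R * eta.
  rewrite zetaE opprD addrACA; apply: le_trans (nrmD _ _) _.
  apply: le_trans (lerD (close' _) (close' _)) _ => /=.
  by rewrite natrD natrM le_eqVlt; apply/orP; left; apply/eqP; ring.
rewrite zeta0 sub0r nrmN in small.
have vpos : 0 < nrm v.
  by rewrite lt_def nrm_ge0 andbT; apply: contraNneq v0 => /nrm_eq0 ->.
have vv : nrm (v + v) = 2 * nrm v.
  have -> : v + v = 2%:C%C *: v by rewrite rmorphMn /= scaler_nat mulr2n.
  by rewrite nrmZ ger0_norm.
have h : (64 * l + 8)%:R * eta = nrm v by rewrite /eta mulrA divff ?mul1r// pnatr_eq0 addn_eq0.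
have h2 : (64 * l + 7)%:R * eta <= (64 * l + 8)%:R * eta.
  by rewrite ler_wpM2r// ler_nat leq_add2l.
by rewrite vv in small; lra.
Qed.

End Criterion.

(** * The probability of failure at a given length *)

Section FailureProbability.
Variables (R : realType) (k : nat) (hk : (2 <= k)%N).
Local Notation K := (2 * k - 1)%N.

Lemma card_relator_sets (l N : nat) : (N <= #|cyc_words k l|)%N ->
  (0 < #|relator_sets k l N|)%N.
Proof.
move=> Nle; apply/card_gt0P.
exists [set x in take N (enum (cyc_words k l))]%SET.
rewrite finset.inE; apply/andP; split.
  by apply/fintype.subsetP => x; rewrite finset.inE => /mem_take; rewrite mem_enum.
rewrite cardsE; have /card_uniqP -> := take_uniq N (enum_uniq (cyc_words k l)).
by rewrite size_takel// -cardE.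
Qed.

Lemma gromov_prob_le1 (l N : nat) P : gromov_prob R k l N P <= 1.
Proof.
rewrite /gromov_prob; case: (posnP #|relator_sets k l N|) => [->|h].
  by rewrite invr0 mulr0.
rewrite ler_pdivrMr ?ltr0n// mul1r ler_nat subset_leq_card//.
by apply/fintype.subsetP => S; rewrite finset.inE => /andP[].
Qed.

Section FixedLength.
Variables (m j N q : nat).
Local Notation l := (3 * m + 2 * j + 4)%N.
Local Notation Om := (reduced_tuple k m j).
Local Notation delta := (N%:R * mean_degree R hk m j).

Lemma card_reduced_tuple : #|{: Om}| = #|cyc_words k l|.
Proof. by rewrite card_sig; apply: eq_card => w; rewrite inE. Qed.

(** Sets of relators are the images of sets of elements of reduced_tuple; a good
    sample inside such a set gives property (T). *)
Lemma gromov_failure_le : (0 < #|{: loop hk m}|)%N -> (5 <= m)%N ->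
  (N <= #|cyc_words k l|)%N -> 0 < delta ->
  1 - gromov_prob R k l N (property_T R) <=
  avg (fun ws : {ffun 'I_N -> Om} => (~~ good_relators R hk q ws)%:R).
Proof.
move=> n0 m5 Nle d0; have rel0 := card_relator_sets Nle.
pose phi (S : {set Om}) : {set l.-tuple (letter 'I_k)} := val @: S.
have phiI : injective phi by apply: imset_inj; exact: val_inj.
pose T (S : {set l.-tuple (letter 'I_k)}) := `[< property_T R (gromov_group S) >].
have relE : relator_sets k l N = phi @: [set S : {set Om} | #|S| == N]%SET.
  apply/setP => S; rewrite finset.inE; apply/andP/imsetP => [[Ssub SN]|[S' + ->]].
    exists [set y : Om | val y \in S]%SET.
      rewrite finset.inE -(card_imset _ val_inj) -(eqP SN); apply/eqP/eq_card => w.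
      apply/imsetP/idP => [[y]|wS]; first by rewrite finset.inE => yS ->.
      by exists (exist (fun w => w \in cyc_words k l) w (fintype.subsetP Ssub _ wS));
        rewrite ?finset.inE.
    apply/setP => w; apply/idP/imsetP => [wS|[y]]; last by rewrite finset.inE => yS ->.
    by exists (exist (fun w => w \in cyc_words k l) w (fintype.subsetP Ssub _ wS));
      rewrite ?finset.inE.
  rewrite finset.inE => /eqP S'N; rewrite (card_imset _ val_inj) S'N.
  by split=> //; apply/fintype.subsetP => w /imsetP[y _ ->]; exact: valP.
have badE : #|[set S in relator_sets k l N | ~~ T S]%SET| =
    #|[set S : {set Om} | (#|S| == N) && ~~ T (phi S)]%SET|.
  rewrite -[RHS](card_imset _ phiI); apply: eq_card => S.
  rewrite finset.inE relE; apply/andP/imsetP => [[/imsetP[S' S'N ->] TS]|[S' + ->]].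
    by exists S' => //; rewrite finset.inE TS andbT; rewrite finset.inE in S'N.
  by rewrite finset.inE => /andP[S'N TS]; split=> //; rewrite imset_f// finset.inE.
have -> : 1 - gromov_prob R k l N (property_T R) =
    #|[set S in relator_sets k l N | ~~ T S]%SET|%:R / #|relator_sets k l N|%:R.
  have c : (#|relator_sets k l N| = #|[set S in relator_sets k l N | T S]%SET| +
      #|[set S in relator_sets k l N | ~~ T S]%SET|)%N.
    rewrite -(cardsID [set S | T S]%SET); congr (_ + _)%N; apply: eq_card => S.
      by rewrite !finset.inE.
    by rewrite !finset.inE andbC.
  have R0 : #|relator_sets k l N|%:R != 0 :> R by rewrite pnatr_eq0 -lt0n.
  rewrite /gromov_prob -[X in X - _](divff R0) -mulrBl; congr (_ / _).
  by rewrite [in X in X - _]c natrD addrAC subrr add0r.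
rewrite badE relE card_imset// mulrC ler_pdivrMl; last first.
  by rewrite ltr0n -(card_imset _ phiI) -relE.
apply: (@random_subset_le_sample R Om N (good_relators R hk q) (fun S => ~~ T (phi S))).
  by rewrite card_reduced_tuple.
move=> ws S wsS good; rewrite negbK; apply/asboolP.
apply: (property_T_of_good_relators n0 m5 d0 good) => i.
by exists (val (ws i)) => //=; rewrite imset_f.
Qed.

End FixedLength.

Lemma K_ge3 : 3 <= K%:R :> R.
Proof. by rewrite ler_nat; lia. Qed.

Lemma loop_gt0 m : (5 <= m)%N -> (0 < #|{: loop hk m}|)%N.
Proof.
move=> m5; have e : ((m - 3).+3 = m)%N by lia.
have := card_loop_ge hk (m - 3); rewrite e.
by apply: leq_trans; rewrite expn_gt0; apply/orP; left; lia.
Qed.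

(** Chosen so that the moment bound at order p <= 2l is at most K^(-3p), which
    beats the square of the number of vertices. *)
Definition degree_const : R := 2 * moment_const R * K%:R ^+ 3.

Lemma degree_const_ge : 16 * K%:R <= degree_const.
Proof.
have K3 := K_ge3; rewrite /degree_const; set x : R := K%:R in K3 *.
have x3 : x <= x ^+ 3 by rewrite exprS ler_peMr//; nra.
by have := moment_const_ge8 R; set c := moment_const R => c8; nra.
Qed.

Lemma card_cyc_words_le_pow l : (0 < l)%N -> (#|cyc_words k l| <= 2 * K ^ l)%N.
Proof.
case: l => // l _; apply: leq_trans (card_cyc_words_le hk l) _.
by rewrite expnS mulnA leq_mul2r; apply/orP; right; lia.
Qed.

Lemma power_of_two_between l : (1 < l)%N -> exists q, (l <= 2 ^ q <= 2 * l)%N.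
Proof.
move=> l1; have /andP[q1 q2] := up_log_bounds (isT : (1 < 2)%N) l1.
exists (up_log 2 l); rewrite q2 /=.
have q0 : (0 < up_log 2 l)%N by rewrite up_log_gt0.
by rewrite -(prednK q0) expnS leq_mul2l /= ltnW.
Qed.

Section Tails.
Variables (x n delta c : R) (l p : nat).
Hypotheses (x1 : 1 <= x) (n0 : 0 <= n) (nle : n <= 2 * x ^+ l) (delta0 : 0 < delta).

Let xp : 0 < x. Proof. exact: lt_le_trans x1. Qed.
Let x0 : 0 <= x. Proof. exact: ltW. Qed.
Let xV0 : 0 <= x^-1. Proof. by rewrite invr_ge0. Qed.
Let xl0 : 0 < x ^+ l. Proof. exact: exprn_gt0. Qed.

Lemma degree_tail_le : 16 * x * l%:R <= delta ->
  3 * n * expR (- delta / 8) <= 6 * x^-1 ^+ l.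
Proof.
move=> dl; have ed : expR (- delta / 8) <= (x^-1 ^+ l) ^+ 2.
  rewrite !exprVn mulNr expRN lef_pV2 ?posrE ?expR_gt0 ?exprn_gt0//.
  rewrite -exprM mulnC; apply: (@le_trans _ _ (expR x ^+ (2 * l))).
    apply: lerXn2r; rewrite ?nnegrE ?expR_ge0//.
    by apply: le_trans (expR_ge1Dx _); lra.
  by rewrite -expRM_natl ler_expR natrM; lra.
apply: (@le_trans _ _ (3 * (2 * x ^+ l) * (x^-1 ^+ l) ^+ 2)).
  by apply: ler_pM ed; rewrite ?expR_ge0 ?mulr_ge0//; rewrite ler_pM2l.
by rewrite exprVn le_eqVlt; apply/orP; left; apply/eqP; field; rewrite gt_eqF.
Qed.

Lemma moment_tail_le : 0 <= c -> (l <= p <= 2 * l)%N -> 2 * c * x ^+ 3 * l%:R <= delta ->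
  (3 * n) ^+ 2 * (c * p%:R / delta) ^+ p <= 36 * x^-1 ^+ l.
Proof.
move=> c0 /andP[lp pl] dl.
have b0 : 0 <= c * p%:R / delta by apply: divr_ge0; [exact: mulr_ge0 | exact: ltW].
have base : c * p%:R / delta <= x^-1 ^+ 3.
  rewrite ler_pdivrMr// exprVn ler_pdivlMl ?exprn_gt0//; apply: le_trans dl.
  have pR : p%:R <= 2 * l%:R :> R by rewrite -natrM ler_nat.
  have cx : 0 <= c * x ^+ 3 by rewrite mulr_ge0// exprn_ge0.
  by have := ler_wpM2l cx pR; lra.
have pw : (c * p%:R / delta) ^+ p <= (x^-1 ^+ l) ^+ 3.
  apply: (@le_trans _ _ ((x^-1 ^+ 3) ^+ p)).
    by apply: lerXn2r; rewrite ?nnegrE ?exprn_ge0.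
  rewrite -!exprM [(l * 3)%N]mulnC !exprM.
  apply: ler_wiXn2l => //; first by rewrite exprn_ge0.
  by rewrite exprn_ile1// invf_le1.
apply: (@le_trans _ _ ((3 * (2 * x ^+ l)) ^+ 2 * (x^-1 ^+ l) ^+ 3)).
  apply: ler_pM; rewrite ?sqr_ge0 ?exprn_ge0//.
  have m1 : 0 <= 3 * n by rewrite mulr_ge0.
  have m2 : 3 * n <= 3 * (2 * x ^+ l) by rewrite ler_pM2l.
  by apply: lerXn2r; rewrite ?nnegrE// (le_trans m1).
by rewrite exprVn le_eqVlt; apply/orP; left; apply/eqP; field; rewrite gt_eqF.
Qed.

End Tails.

Lemma failure_le_exp (m j N : nat) : (5 <= m)%N ->
  (N <= #|cyc_words k (3 * m + 2 * j + 4)|)%N ->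
  degree_const * (3 * m + 2 * j + 4)%:R <= N%:R * mean_degree R hk m j ->
  1 - gromov_prob R k (3 * m + 2 * j + 4) N (property_T R) <=
  42 * (K%:R^-1) ^+ (3 * m + 2 * j + 4).
Proof.
move=> m5 Nle; have l1 : (1 < 3 * m + 2 * j + 4)%N by lia.
have c8 := moment_const_ge8 R; have := degree_const_ge; have K3 := K_ge3.
rewrite /degree_const; set x : R := K%:R in K3 *; set c := moment_const R in c8 *.
move=> dc dl; set delta := _ * mean_degree R hk m j in dl.
have n0 := loop_gt0 m5.
have nle : #|{: loop hk m}|%:R <= 2 * x ^+ (3 * m + 2 * j + 4).
  rewrite /x -natrX -natrM ler_nat.
  apply: leq_trans (card_cyc_words_le_pow (ltnW l1)).
  rewrite -card_reduced_tuple; apply: leq_trans (card_loops_le hk m j).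
  by rewrite -[X in (X <= _)%N]expn1 leq_pexp2l.
have lR : 1 <= (3 * m + 2 * j + 4)%:R :> R by rewrite ler1n ltnW.
have [q /[dup] q2l /andP[_ pl]] := power_of_two_between l1.
have pR : (2 ^ q)%:R <= 2 * (3 * m + 2 * j + 4)%:R :> R by rewrite -natrM ler_nat.
have nvR : #|{: vertex hk m}|%:R = 3 * #|{: loop hk m}|%:R :> R by rewrite nvE natrM.
move: (3 * m + 2 * j + 4)%N l1 lR q2l pl pR nle dl Nle
  (@gromov_failure_le m j N q n0 m5) => l l1 lR q2l pl pR nle dl Nle fail.
have d16 : 16 * x * l%:R <= delta by apply: le_trans dl; rewrite ler_wpM2r//; lra.
have d0 : 0 < delta by nra.
have x1 : 1 <= x by lra.
apply: le_trans (fail Nle d0) _.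
apply: le_trans (good_relators_prob n0 (q := q) _ _) _; rewrite -/delta.
- by nra.
- by nra.
have c0 : 0 <= c by apply: le_trans c8.
have t1 := degree_tail_le x1 (ler0n _ _) nle d16.
have t2 := moment_tail_le x1 (ler0n _ _) nle d0 c0 q2l dl.
rewrite nvR; apply: le_trans (lerD t1 t2) _.
by lra.
Qed.

End FailureProbability.

(** * The limit of large length *)

Section Asymptotics.
Variables (R : realType) (k : nat) (hk : (2 <= k)%N).
Local Notation K := (2 * k - 1)%N.
Local Notation Kr := (K%:R : R).

(** The residue of l modulo 3 is adjusted by j, since 2 is invertible modulo 3. *)
Lemma length_decomposition (l : nat) : (23 <= l)%N ->
  exists m j, [/\ l = (3 * m + 2 * j + 4)%N, (5 <= m)%N & (j <= 2)%N].
Proof.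
move=> l23; exists ((l - 4 - 2 * ((2 * (l - 4)) %% 3)) %/ 3)%N, ((2 * (l - 4)) %% 3)%N.
by split; lia.
Qed.

Lemma KrE : 2 * k%:R - 1 = Kr.
Proof. by rewrite natrB ?natrM//; lia. Qed.

Lemma card_cyc_words_ge_pow l : (23 <= l)%N -> (K ^ (l - 17) <= #|cyc_words k l|)%N.
Proof.
move=> /length_decomposition[m [j [-> m5 j2]]].
have e : ((m - 3).+3 = m)%N by lia.
have := card_loop_ge hk (m - 3); rewrite e => h.
rewrite -card_reduced_tuple; apply: leq_trans (card_loops_le hk m j).
apply: leq_trans (_ : ((K ^ (m - 3)) ^ 3 <= _)%N); last by rewrite leq_exp2r.
by rewrite -expnM leq_pexp2l//; lia.
Qed.

Lemma cube_root_pow (l : nat) : (Kr `^ (l%:R / 3)) ^+ 3 = Kr ^+ l.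
Proof.
by rewrite -powR_mulrn ?powR_ge0// -powRrM divfK// powR_mulrn.
Qed.

(** The expected degree in a sample is 2 N n^2 / #|cyc_words|, where the number n of
    loops is at least K^(m-3) and the number of cyclically reduced words at most
    2 K^l; with g = K^(l/3), so that g^3 = K^l and g <= K^(m+3), this is at least
    N / (K^12 g). *)
Lemma degree_large (m j N : nat) (l := (3 * m + 2 * j + 4)%N) (D : R) :
  (5 <= m)%N -> (j <= 2)%N -> 0 <= D ->
  D * Kr ^+ 12 * l%:R * Kr `^ (l%:R / 3) <= N%:R ->
  D * l%:R <= N%:R * mean_degree R hk m j.
Proof.
move=> m5 j2 D0; have Krp : 0 < Kr by rewrite ltr0n; lia.
set g := Kr `^ _ => hN; have g0 : 0 <= g by exact: powR_ge0.
have g3 : g ^+ 3 = Kr ^+ l by exact: cube_root_pow.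
have gle : g <= Kr ^+ (m + 3).
  rewrite -(@ler_pXn2r _ 3)// ?nnegrE ?exprn_ge0 ?ler0n// g3 -exprM.
  by rewrite ler_weXn2l// ?ler1n; [lia | rewrite /l; lia].
have Om0 : 0 < #|{: reduced_tuple k m j}|%:R :> R.
  by rewrite ltr0n; apply: Om_gt0; exact: loop_gt0.
rewrite /mean_degree mulrA ler_pdivlMr//.
have OmK : #|{: reduced_tuple k m j}|%:R <= 2 * (g * g ^+ 2).
  rewrite -exprS g3 -natrX -natrM ler_nat card_reduced_tuple.
  by apply: (card_cyc_words_le_pow hk); rewrite addn_gt0 orbT.
have nK : Kr ^+ (m - 3) <= #|{: loop hk m}|%:R.
  have e : ((m - 3).+3 = m)%N by lia.
  by have := card_loop_ge hk (m - 3); rewrite e -natrX ler_nat.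
have lD : 0 <= D * l%:R by rewrite mulr_ge0.
apply: le_trans (ler_wpM2l lD OmK) _.
have g2 : g ^+ 2 <= Kr ^+ 12 * Kr ^+ (m - 3) ^+ 2.
  rewrite -exprM -exprD; have -> : (12 + (m - 3) * 2 = (m + 3) * 2)%N by lia.
  by rewrite exprM lerXn2r ?nnegrE ?exprn_ge0 ?ler0n.
have n2 : Kr ^+ (m - 3) ^+ 2 <= #|{: loop hk m}|%:R ^+ 2.
  by rewrite lerXn2r ?nnegrE ?exprn_ge0 ?ler0n.
have c0 : 0 <= 2 * (D * l%:R * g) by rewrite !mulr_ge0.
have s1 := ler_wpM2l c0 g2.
have c1 : 0 <= 2 * (D * l%:R * g) * Kr ^+ 12 by rewrite mulr_ge0// exprn_ge0// ltW.
have s2 := ler_wpM2l c1 n2.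
have s3 := ler_wpM2r (sqr_ge0 #|{: loop hk m}|%:R) hN.
move: s1 s2 s3; set a := _ ^+ (m - 3) ^+ 2; set b := _ ^+ 2; set c := Kr ^+ 12.
by set e := _ ^+ 2 => s1 s2 s3; nra.
Qed.

Lemma aas_property_T (f : nat -> nat) :
  (\forall l \near \oo, (f l <= #|cyc_words k l|)%N) ->
  (\forall l \near \oo,
     degree_const R k * Kr ^+ 12 * l%:R * Kr `^ (l%:R / 3) <= (f l)%:R) ->
  gromov_aas R k f (property_T R).
Proof.
move=> f1 f2; have K3 := K_ge3 R hk.
have D0 : 0 <= degree_const R k by apply: le_trans (degree_const_ge R hk); lra.
have low : (1 - 42 * Kr^-1 ^+ l) @[l --> \oo] --> (1 : R).
  rewrite -[X in _ --> X]subr0 -[X in 1 - X](mulr0 42).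
  apply: cvgB; first exact: cvg_cst.
  apply: cvgM; first exact: cvg_cst.
  apply: cvg_expr; rewrite ger0_norm ?invr_ge0// invf_lt1; lra.
apply: (@squeeze_cvgr _ _ _ _ (fun l => 1 - 42 * Kr^-1 ^+ l) (fun=> 1) _ _ _ low); last exact: cvg_cst.
near=> l; rewrite gromov_prob_le1 andbT lerBlDr -lerBlDl.
have l23 : (23 <= l)%N by near: l; exact: nbhs_infty_ge.
have fl : (f l <= #|cyc_words k l|)%N by near: l.
have fl2 : degree_const R k * Kr ^+ 12 * l%:R * Kr `^ (l%:R / 3) <= (f l)%:R by near: l.
have [m [j [lE m5 j2]]] := length_decomposition l23.
move: (f l) fl fl2 => N; rewrite lE => fl fl2.
apply: (@failure_le_exp R k hk m j N m5 fl _).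
exact: degree_large.
Unshelve. all: by end_near.
Qed.

End Asymptotics.

Theorem corollary12p7 (R : realType) (k : nat) (hk : (2 <= k)%N) :
  (exists C : R, 0 < C /\
     forall f : nat -> nat,
       (\forall l \near \oo, (f l <= #|cyc_words k l|)%N) ->
       (\forall l \near \oo,
          C * l%:R * (2 * k%:R - 1) `^ (l%:R / 3) <= (f l)%:R) ->
       gromov_aas R k f (property_T R)) /\
  (forall d : R, 1 / 3 < d < 1 ->
     gromov_aas R k (density_count k d) (property_T R)).
Proof.
have K3 := K_ge3 R hk; set C : R := degree_const R k * (2 * k - 1)%:R ^+ 12.
have C0 : 0 < C.
  apply: mulr_gt0; last by rewrite exprn_gt0//; lra.
  by apply: lt_le_trans (degree_const_ge R hk); lra.
rewrite KrE//; split; first by exists C; split=> // f; exact: aas_property_T.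
move=> d /andP[d3 d1]; apply: aas_property_T => //; rewrite -/C; near=> l.
- have l23 : (23 <= l)%N by near: l; exact: nbhs_infty_ge.
  apply: leq_trans (card_cyc_words_ge_pow hk l23).
  rewrite -(ler_nat R) natrX /density_count KrE//.
  apply: le_trans (_ : (2 * k - 1)%:R `^ (d * l%:R) <= _).
    by rewrite truncn_le powR_ge0.
  rewrite -powR_mulrn// ler_powR//; first by lra.
  rewrite natrB; last by lia.
  have : 17 / (1 - d) <= l%:R by near: l; exact: nbhs_infty_ger.
  by rewrite ler_pdivrMr; lra.
- set Kr : R := (2 * k - 1)%:R in K3 *.
  have lnK : 0 < ln Kr by apply: ln_gt0; lra.
  pose a := d - 1 / 3; have a0 : 0 < a by rewrite /a; lra.
  set g := Kr `^ (l%:R / 3).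
  have l0 : 0 <= l%:R :> R by [].
  have g1 : 1 <= g.
    have K1 : 1 <= Kr by lra.
    by have := ler_powR K1 (divr_ge0 l0 (ler0n R 3)); rewrite powRr0.
  have Kg : Kr `^ (d * l%:R) = g * Kr `^ (a * l%:R).
    rewrite /g -powRD; last by apply/implyP => _; rewrite gt_eqF; lra.
    by congr (_ `^ _); rewrite /a; field.
  have l1 : 1 <= l%:R :> R by near: l; exact: nbhs_infty_ger.
  have b0 : 0 < (a * ln Kr) ^+ 2 by rewrite exprn_gt0// mulr_gt0.
  have lbig : 2 * (C + 1) / (a * ln Kr) ^+ 2 <= l%:R by near: l; exact: nbhs_infty_ger.
  (* A quadratic function of l is eventually larger than a linear one. *)
  have Ka : C * l%:R + 1 <= Kr `^ (a * l%:R).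
    rewrite /powR gt_eqF; last by lra.
    have x0 : 0 <= a * l%:R * ln Kr by rewrite !mulr_ge0// ltW.
    apply: le_trans (expR_ge1Dxn 1 x0); rewrite addrC lerD2l.
    have -> : (a * l%:R * ln Kr) ^+ 2 / 2`!%:R = (a * ln Kr) ^+ 2 * l%:R / 2 * l%:R.
      by rewrite (_ : 2`!%:R = 2 :> R)//; field.
    rewrite ler_wpM2r//; move: lbig; rewrite ler_pdivrMr// mulrC; lra.
  have x0 : 0 <= Kr `^ (d * l%:R) by exact: powR_ge0.
  have := truncn_itv x0; move=> /andP[_].
  rewrite /density_count KrE// -/Kr -natr1 Kg => h.
  have := ler_wpM2l (le_trans ler01 g1) Ka.
  by nra.
Unshelve. all: by end_near.
Qed.
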